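(* Let $H$ and $K$ be complex Hilbert spaces with $K\neq\{0\}$, $\dim(K)<\infty$ and $\dim(H)=\infty$. Then the rectangular complex Cartan factor of type I, $L(H,K)$ (all bounded linear operators from $H$ to $K$ with the operator norm and triple product $\{a,b,c\}=\frac12(ab^*c+cb^*a)$), and all its real forms are not ternary weakly amenable.
   Context: A conjugation on a complex JB$^*$-triple $F$ is a conjugate-linear isometry $\tau:F\to F$ of period 2; the real forms of $F$ are the real JB$^*$-triples $F^\tau=\{x\in F:\tau(x)=x\}$, with the restricted norm and triple product, for $\tau$ a conjugation on $F$. Let $E$ be a real or complex Jordan Banach triple. The dual $E^*$ is a Jordan triple $E$-module with the products $\{a,b,\varphi\}(x)=\{\varphi,b,a\}(x):=\varphi(\{b,a,x\})$ and $\{a,\varphi,b\}(x):=\overline{\varphi(\{a,x,b\})}$ for $a,b,x\in E$, $\varphi\in E^*$ (in the real case the conjugation bar is trivial). A ternary derivation $\delta:E\to E^*$ is a conjugate linear (linear, in the real case) map with $\delta\{a,b,c\}=\{\delta(a),b,c\}+\{a,\delta(b),c\}+\{a,b,\delta(c)\}$ for all $a,b,c\in E$. For $b\in E$, $\varphi\in E^*$, the map $\delta(b,\varphi)(a):=\{b,\varphi,a\}-\{\varphi,b,a\}$ is a ternary derivation $E\to E^*$; finite sums of such maps are called inner ternary derivations. $E$ is ternary weakly amenable if every continuous ternary derivation $E\to E^*$ is inner. *)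

(* Defs.v *)
From HB Require Import structures.
From mathcomp Require Import all_boot all_order all_algebra.
From mathcomp Require Import complex.
From mathcomp Require Import all_classical all_reals all_analysis.

Set Implicit Arguments.
Unset Strict Implicit.
Unset Printing Implicit Defensive.

Import Order.TTheory GRing.Theory Num.Theory.
Import numFieldNormedType.Exports.

Local Open Scope classical_set_scope.
Local Open Scope ring_scope.
Local Open Scope complex_scope.

(* Real or complex scalars over [R], so that operator norms, duals and ternary
   derivations are defined once; the instances are [R] and [R[i]]. Norms in
   MathComp-Analysis take values in the scalar field, hence [rc_re] and
   [rc_inj] to go back and forth between nonnegative scalars and [R]. Only the
   laws needed for operator norms are recorded: [rc_conj] is the identity on [R]
   and complex conjugation on [R[i]]. *)
HB.mixin Record NumField_isRCLike (R : realType) K & Num.NumField K := {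
  rc_re : K -> R;
  rc_inj : R -> K;
  rc_conj : K -> K;
  rc_reK : forall z : K, 0 <= z -> rc_inj (rc_re z) = z;
  rc_inj_le : forall r s : R, (rc_inj r <= rc_inj s) = (r <= s)
}.

#[short(type="rclikeType")]
HB.structure Definition RCLike (R : realType) :=
  {K of NumField_isRCLike R K & Num.NumField K}.

#[non_forgetful_inheritance]
HB.instance Definition _ (R : realType) :=
  @NumField_isRCLike.Build R R idfun idfun idfun
    (fun _ _ => erefl) (fun _ _ => erefl).

Lemma complex_rc_reK (R : realType) (z : R[i]) :
  0 <= z -> (complex.Re z)%:C = z.
Proof. by move=> z0; rewrite RRe_real ?ger0_real. Qed.

HB.instance Definition _ (R : realType) :=
  @NumField_isRCLike.Build R R[i] (@complex.Re R) (fun r => r%:C)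
    (@Num.conj R[i]) (@complex_rc_reK R) (@lecR R).

Definition finite_dimensional (K : numFieldType) (V : lmodType K) : Prop :=
  exists (n : nat) (e : 'I_n -> V),
    forall v : V, exists c : 'I_n -> K, v = \sum_(i < n) c i *: e i.

Section BoundedOperators.
Variables (R : realType) (K : rclikeType R) (V W : normedModType K).

Definition continuous_linear : {pred V -> W} :=
  fun f => `[< linear f /\ continuous f >].

Lemma continuous_linear_submod_closed : submod_closed continuous_linear.
Proof.
split=> [|k f g /asboolP[lf cf] /asboolP[lg cg]]; apply/asboolP; split.
- by move=> k x y; rewrite scaler0 addr0.
- by move=> x; exact: cvg_cst.
- move=> a x y; rewrite !fctE lf lg !scalerDr !scalerA.
  by rewrite (mulrC k) addrACA.
- by move=> x; apply: cvgD; [apply: cvgZl_tmp; exact: cf|exact: cg].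
Qed.

HB.instance Definition _ := GRing.isSubmodClosed.Build K (V -> W)
  continuous_linear continuous_linear_submod_closed.

Record bounded_op := BoundedOp {
  bounded_op_fun :> V -> W ;
  _ : bounded_op_fun \in continuous_linear }.

HB.instance Definition _ := [isSub for bounded_op_fun].
HB.instance Definition _ := [Choice of bounded_op by <:].
HB.instance Definition _ := [SubChoice_isSubLmodule of bounded_op by <:].

Lemma bounded_op_linear (f : bounded_op) : linear f.
Proof. by have /asboolP[] := valP f. Qed.

Lemma bounded_op_continuous (f : bounded_op) : continuous f.
Proof. by have /asboolP[] := valP f. Qed.

HB.instance Definition _ (f : bounded_op) :=
  GRing.isLinear.Build K V W *:%R f (bounded_op_linear f).

Definition opnorm (f : bounded_op) : K :=
  rc_inj (sup [set rc_re `|f x| | x in [set x : V | `|x| <= 1]]).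

Lemma bounded_op_bound (f : bounded_op) :
  exists2 M : K, 0 <= M & forall x, `|f x| <= M * `|x|.
Proof.
have /linear_bounded_continuous/linear_boundedP fM := @bounded_op_continuous f.
near +oo_K => M; exists M; first by near: M; apply: nbhs_pinfty_ge.
by near: M.
Unshelve. all: by end_near. Qed.

Let rc_re_le (z w : K) : 0 <= z -> 0 <= w ->
  (rc_re z <= rc_re w :> R) = (z <= w).
Proof. by move=> z0 w0; rewrite -(@rc_inj_le R K) !rc_reK. Qed.

Let rc_reI (r : R) : 0 <= (rc_inj r : K) -> rc_re (rc_inj r : K) = r.
Proof.
by move=> r0; apply/eqP; rewrite eq_le -!(@rc_inj_le R K) rc_reK// lexx.
Qed.

Let opnorm_set_has_sup (f : bounded_op) :
  has_sup [set (rc_re `|f x| : R) | x in [set x : V | `|x| <= 1]].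
Proof.
split; first by exists (rc_re `|f 0|); exists 0 => //=; rewrite normr0.
have [M M0 fM] := bounded_op_bound f.
exists (rc_re M) => _ [x /= x1 <-]; rewrite rc_re_le//.
by rewrite (le_trans (fM x))// ler_piMr.
Qed.

Let le_opnorm1 (f : bounded_op) (x : V) : `|x| <= 1 -> `|f x| <= opnorm f.
Proof.
move=> x1; rewrite -(@rc_reK R K `|f x|)// rc_inj_le.
by apply: ub_le_sup; [case: (opnorm_set_has_sup f)|exists x].
Qed.

Lemma opnorm_ge0 (f : bounded_op) : 0 <= opnorm f.
Proof. by apply: le_trans (@le_opnorm1 f 0 _); rewrite ?normr0. Qed.

Lemma le_opnorm (f : bounded_op) (x : V) : `|f x| <= opnorm f * `|x|.
Proof.
have [->|x0] := eqVneq x 0; first by rewrite linear0 !normr0 mulr0.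
have nx0 : 0 < `|x| by rewrite normr_gt0.
rewrite -ler_pdivrMr// mulrC -[X in X * _]ger0_norm ?invr_ge0// -normrZ.
rewrite -linearZ; apply: le_opnorm1.
by rewrite normrZ ger0_norm ?invr_ge0// mulVf// gt_eqF.
Qed.

Lemma opnorm_le (f : bounded_op) (M : K) :
  0 <= M -> (forall x, `|f x| <= M * `|x|) -> opnorm f <= M.
Proof.
move=> M0 fM; rewrite -(@rc_reK R K M)// rc_inj_le.
apply: ge_sup; first by case: (opnorm_set_has_sup f).
move=> _ [x /= x1 <-]; rewrite rc_re_le//.
by rewrite (le_trans (fM x))// ler_piMr.
Qed.

Let opnormD (f g : bounded_op) : opnorm (f + g) <= opnorm f + opnorm g.
Proof.
apply: opnorm_le => [|x]; first by rewrite addr_ge0 ?opnorm_ge0.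
by rewrite mulrDl (le_trans (ler_normD _ _))// lerD ?le_opnorm.
Qed.

Let opnormZ_le (k : K) (f : bounded_op) : opnorm (k *: f) <= `|k| * opnorm f.
Proof.
apply: opnorm_le => [|x]; first by rewrite mulr_ge0 ?opnorm_ge0.
by rewrite normrZ -mulrA ler_wpM2l ?le_opnorm.
Qed.

Let opnormZ (k : K) (f : bounded_op) : opnorm (k *: f) = `|k| * opnorm f.
Proof.
apply/eqP; rewrite eq_le opnormZ_le/=; have [->|k0] := eqVneq k 0.
  by rewrite normr0 mul0r opnorm_ge0.
rewrite -ler_pdivlMl ?normr_gt0// -normfV.
by rewrite -[X in opnorm X <= _](scalerK k0); exact: opnormZ_le.
Qed.

Let opnorm0_eq0 (f : bounded_op) : opnorm f = 0 -> f = 0.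
Proof.
move=> f0; apply/val_inj/funext => x; apply/eqP.
by rewrite -normr_le0 (le_trans (le_opnorm f x))// f0 mul0r.
Qed.

HB.instance Definition _ := Lmodule_isNormed.Build K bounded_op
  opnormD opnormZ opnorm0_eq0.

End BoundedOperators.

Arguments bounded_op {R K} V W.

Section Composition.
Variables (R : realType) (K : rclikeType R) (U V W : normedModType K).

Lemma comp_continuous_linear (g : bounded_op V W) (f : bounded_op U V) :
  g \o f \in @continuous_linear R K U W.
Proof.
apply/asboolP; split=> [k x y|x]; first by rewrite /= !linearP.
by apply: continuous_comp; exact: bounded_op_continuous.
Qed.

Definition op_comp (g : bounded_op V W) (f : bounded_op U V) :
  bounded_op U W := BoundedOp (comp_continuous_linear g f).

End Composition.

Definition dual (R : realType) (K : rclikeType R) (E : normedModType K) :=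
  bounded_op E K^o.

(* [t] is the triple product of [E]. Elements of the dual such as
   {a, b, phi} are given by their values at the points [x] of [E]. *)

Section TernaryWeakAmenability.
Variables (R : realType) (K : rclikeType R) (E : normedModType K).
Variable t : E -> E -> E -> E.

(* {phi, b, a}(x) = {a, b, phi}(x) *)
Definition outer_product (a b : E) (phi : dual E) (x : E) : K :=
  phi (t b a x).

(* {a, phi, b}(x) *)
Definition middle_product (a : E) (phi : dual E) (b x : E) : K :=
  rc_conj (phi (t a x b)).

Definition ternary_derivation (delta : E -> dual E) : Prop :=
  (forall (k : K) (a b : E),
     delta (k *: a + b) = rc_conj k *: delta a + delta b) /\
  (forall a b c x : E,
     delta (t a b c) x = outer_product c b (delta a) x
                         + middle_product a (delta b) c x
                         + outer_product a b (delta c) x).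

Definition inner_derivation (b : E) (phi : dual E) (a x : E) : K :=
  middle_product b phi a x - outer_product a b phi x.

Definition is_inner (delta : E -> dual E) : Prop :=
  exists s : seq (E * dual E), forall a x : E,
    delta a x = \sum_(p <- s) inner_derivation p.1 p.2 a x.

Definition ternary_weakly_amenable : Prop :=
  forall delta : E -> dual E,
    ternary_derivation delta -> continuous delta -> is_inner delta.

End TernaryWeakAmenability.

Record conjugation (R : realType) (F : normedModType R[i]) := Conjugation {
  conjugation_fun :> F -> F;
  conjugation_conjlinear : forall (k : R[i]) (x y : F),
    conjugation_fun (k *: x + y) =
    Num.conj k *: conjugation_fun x + conjugation_fun y;
  conjugation_isometry : forall x : F, `|conjugation_fun x| = `|x|;
  conjugation_involutive : involutive conjugation_fun }.

Section RealForm.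
Variables (R : realType) (F : normedModType R[i]) (tau : conjugation F).

Definition fixed_points : {pred F} := fun x => tau x == x.

Lemma fixed_points_zmod_closed : zmod_closed fixed_points.
Proof.
have tau0 : tau 0 = 0.
  have := conjugation_conjlinear tau 1 0 0.
  by rewrite rmorph1 !scale1r addr0 => /(congr1 (+%R^~ (- tau 0)));
     rewrite addrK subrr.
split=> [|x y /eqP tx /eqP ty]; apply/eqP; first exact: tau0.
have := conjugation_conjlinear tau (-1) y x.
by rewrite rmorphN1 !scaleN1r tx ty ![- y + _]addrC.
Qed.

HB.instance Definition _ := GRing.isZmodClosed.Build F
  fixed_points fixed_points_zmod_closed.

Record real_form := RealForm {
  real_form_val :> F ;
  _ : real_form_val \in fixed_points }.

HB.instance Definition _ := [isSub for real_form_val].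
HB.instance Definition _ := [Choice of real_form by <:].
HB.instance Definition _ := [SubChoice_isSubZmodule of real_form by <:].

Lemma real_form_fixed (x : real_form) : tau (val x) = val x.
Proof. by apply/eqP; exact: (valP x). Qed.

Lemma fixed_points_scale (r : R) (x : real_form) :
  r%:C *: val x \in fixed_points.
Proof.
have tau0 : tau 0 = 0 by apply/eqP; exact: (rpred0 fixed_points).
apply/eqP; have := conjugation_conjlinear tau r%:C (val x) 0.
rewrite tau0 !addr0 real_form_fixed => ->; congr (_ *: _).
by apply: CrealP; apply/complex_realP; exists r.
Qed.

Definition real_form_scale (r : R) (x : real_form) : real_form :=
  RealForm (fixed_points_scale r x).

Let scaleA (a b : R) (v : real_form) :
  real_form_scale a (real_form_scale b v) = real_form_scale (a * b) v.
Proof. by apply: val_inj; rewrite /= scalerA -rmorphM. Qed.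

Let scale1 : left_id 1 real_form_scale.
Proof. by move=> v; apply: val_inj; rewrite /= rmorph1 scale1r. Qed.

Let scaleDr : right_distributive real_form_scale +%R.
Proof. by move=> a u v; apply: val_inj; rewrite /= scalerDr. Qed.

Let scaleDl (v : real_form) : {morph real_form_scale^~ v : a b / a + b}.
Proof. by move=> a b; apply: val_inj; rewrite /= rmorphD scalerDl. Qed.

HB.instance Definition _ := GRing.Zmodule_isLmodule.Build R real_form
  scaleA scale1 scaleDr scaleDl.

(* [`|val x|] is a nonnegative element of [R[i]]; its real part is the same
   number in [R]. *)
Definition real_form_norm (x : real_form) : R := complex.Re `|val x|.

Let real_form_normC (x : real_form) : (real_form_norm x)%:C = `|val x|.
Proof. exact: complex_rc_reK. Qed.

Let normD (x y : real_form) :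
  real_form_norm (x + y) <= real_form_norm x + real_form_norm y.
Proof. by rewrite -lecR rmorphD/= !real_form_normC ler_normD. Qed.

Let normZ (r : R) (x : real_form) :
  real_form_norm (r *: x) = `|r| * real_form_norm x.
Proof.
apply: complexI; rewrite rmorphM/= !real_form_normC/= normrZ; congr (_ * _).
by rewrite normc_def/= expr0n/= addr0 sqrtr_sqr.
Qed.

Let norm0_eq0 (x : real_form) : real_form_norm x = 0 -> x = 0.
Proof.
move=> x0; apply: val_inj; apply/eqP => /=.
by rewrite -normr_eq0 -real_form_normC x0.
Qed.

HB.instance Definition _ := Lmodule_isNormed.Build R real_form
  normD normZ norm0_eq0.

(* The restriction to the real form of a triple product [t] on [F]. A
   conjugation of a JB*-triple preserves the triple product (Kaup), so that
   [t x y z] is a fixed point and the default value 0 of [insubd] is not used. *)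
Definition real_form_triple (t : F -> F -> F -> F) (x y z : real_form) :
  real_form := insubd 0 (t (val x) (val y) (val z)).

End RealForm.

(* [{dot V for conj}] is linear in its first variable. *)

HB.mixin Record NormedModule_isInnerProduct (R : realType) V
    & NormedModule R[i] V := {
  inner : {dot V for @Num.conj R[i]};
  inner_normE : forall x : V, inner x x = `|x| ^+ 2
}.

#[short(type="hilbertType")]
HB.structure Definition Hilbert (R : realType) :=
  {V of NormedModule_isInnerProduct R V & CompleteNormedModule R[i] V}.

Section Rectangular.
Variables (R : realType).

(* The adjoint exists and is unique by the Riesz representation theorem. *)
Definition adjoint (H K : hilbertType R) (a : bounded_op H K) :
    bounded_op K H :=
  xget 0 [set b : bounded_op K H |
    forall (x : H) (y : K), inner (a x) y = inner x (b y)].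

Definition cartan_triple (H K : hilbertType R) (a b c : bounded_op H K) :
    bounded_op H K :=
  2^-1 *: (op_comp a (op_comp (adjoint b) c)
           + op_comp c (op_comp (adjoint b) a)).

End Rectangular.

(* Main.v *)
Require Import Defs.
From HB Require Import structures.
From mathcomp Require Import all_boot all_order all_algebra.
From mathcomp Require Import complex.
From mathcomp Require Import all_classical all_reals all_analysis.
From mathcomp Require Import ring lra.

Set Implicit Arguments.
Unset Strict Implicit.
Unset Printing Implicit Defensive.

Import Order.TTheory GRing.Theory Num.Theory.
Import numFieldNormedType.Exports.

Local Open Scope ring_scope.
Local Open Scope complex_scope.
Local Notation "z ^*" := (Num.conj z) : complex_scope.

(** Write E for L(H,K), and a^† for the adjoint of a. The pairing tr (x c^†)
    identifies E with its dual as a Jordan module, so ternary derivations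
    E -> E^* are given by triple derivations of E; one family of these is
    a |-> a T with T a bounded skew-adjoint operator on H. In an inner derivation
    every term delta(b,phi) depends on b, and b has finite rank because K is
    finite dimensional: an inner derivation vanishes on elements a, x that are
    right orthogonal to each other and to the finitely many b's involved
    (a b^† = x b^† = 0), which is a finite number of conditions. A skew T of
    infinite rank therefore gives a derivation that is not inner, as soon as such
    a, x can be found with Re tr (x T a^†) > 0.

    For a real form the same derivation, restricted to the fixed points of tau
    and followed by the real part, is still a ternary derivation, and only two
    things have to be provided.

    First, tau preserves the triple product, so that the triple product of E does
    restrict to the fixed points ([tau_triple]). This is the theorem of Kaup on
    isometries, here obtained from the geometry of the unit ball: partial
    isometries u and orthogonality to u are characterised by the norm
    ([orth_of_contraction], [contraction_orth_sum], [sq_add_defect]), hence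
    preserved by tau ([tau_tripotent], [tau_orth]); singular value decomposition
    gives tau (x x^† x) = tau x (tau x)^† tau x, and polarization the rest.

    Secondly, the fixed points contain enough mutually right orthogonal elements
    ([dense_range_sequence]). Right orthogonality alone is not a triple notion,
    but right orthogonality to a surjective z is: it reads z w^† z = 0. Full
    orthogonality is one as well, and a maximal orthogonal family sums to a
    surjective element. So a sequence of surjective fixed points z_n with
    z_n z_m^† = 0 for n != m can be built greedily.

    With a_k = z_(2k), x_k = z_(2k+1), the operator T is a weighted sum of the
    skew operators p_k^† q_k - q_k^† p_k, where p_k and q_k are the cubes of x_k
    and a_k. Finitely many b's are annihilated by a common nonzero real
    combination a = sum g_k a_k, x = sum g_k x_k of these two sequences, and
    Re tr (x T a^†) is a sum of g_k^2 with positive coefficients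
    ([noninner_trace_form]).

    Taking all of E instead of the fixed points settles the complex case; both
    cases are treated at once through the notion of a rich subset ([rich]). *)

(** * The real inner product of a complex Hilbert space *)

Section InnerProduct.
Context {R : realType} {V : hilbertType R}.
Implicit Types x y z : V.

Lemma innerDl x y z : inner (x + y) z = inner x z + inner y z.
Proof. exact: linearDl. Qed.

Lemma innerZl (a : R[i]) x z : inner (a *: x) z = a * inner x z.
Proof. exact: linearZl_LR. Qed.

Lemma innerC x y : inner x y = (inner y x)^*.
Proof. by have := hermC inner x y; rewrite expr0 mul1r. Qed.

Lemma innerDr x y z : inner z (x + y) = inner z x + inner z y.
Proof. exact: linearDr. Qed.

Lemma innerZr (a : R[i]) x z : inner z (a *: x) = a^* * inner z x.
Proof.
by rewrite innerC innerZl rmorphM; congr (_ * _); rewrite [RHS]innerC.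
Qed.

Lemma inner0l x : inner 0 x = 0. Proof. exact: linear0l. Qed.
Lemma inner0r x : inner x 0 = 0. Proof. exact: linear0r. Qed.
Lemma innerNl x y : inner (- x) y = - inner x y. Proof. exact: linearNl. Qed.
Lemma innerNr x y : inner x (- y) = - inner x y. Proof. exact: linearNr. Qed.

Lemma inner_suml I (s : seq I) (F : I -> V) y :
  inner (\sum_(i <- s) F i) y = \sum_(i <- s) inner (F i) y.
Proof. exact: linear_sumlz. Qed.

Lemma inner_sumr I (s : seq I) (F : I -> V) y :
  inner y (\sum_(i <- s) F i) = \sum_(i <- s) inner y (F i).
Proof. exact: linear_sumr. Qed.

(** Norms and inner products take values in R[i], which is only partially
    ordered; all estimates are made on these real-valued versions. *)
Definition rin x y : R := complex.Re (inner x y).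
Definition sq x : R := rin x x.

Lemma inner_sq x : inner x x = (sq x)%:C.
Proof. by rewrite /sq /rin RRe_real// inner_normE realX// normr_real. Qed.

Lemma norm_sq x : `|x| = (Num.sqrt (sq x))%:C.
Proof.
have Hx : `|x| = (complex.Re `|x|)%:C by rewrite complex_rc_reK.
have h0 : 0 <= complex.Re `|x| by rewrite -lecR -Hx; exact: normr_ge0.
rewrite [LHS]Hx; congr (_%:C); rewrite -[LHS]ger0_norm// -sqrtr_sqr.
congr Num.sqrt; apply: complexI.
by rewrite rmorphXn/= -Hx -inner_normE inner_sq.
Qed.

Lemma sq_ge0 x : 0 <= sq x.
Proof. by rewrite -lecR -inner_sq inner_normE exprn_ge0. Qed.

Lemma sq_eq0 x : (sq x == 0) = (x == 0).
Proof.
by rewrite -(inj_eq (@complexI R)) -inner_sq inner_normE sqrf_eq0 normr_eq0.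
Qed.

Lemma sq_gt0 x : (0 < sq x) = (x != 0).
Proof. by rewrite lt_def sq_ge0 andbT sq_eq0. Qed.

Lemma sq0P x : sq x = 0 -> x = 0.
Proof. by move/eqP; rewrite sq_eq0 => /eqP. Qed.

Lemma rinC x y : rin x y = rin y x.
Proof. by rewrite /rin [in LHS]innerC; case: (inner y x). Qed.

Lemma rinDl x y z : rin (x + y) z = rin x z + rin y z.
Proof. by rewrite /rin innerDl raddfD. Qed.

Lemma rinDr x y z : rin z (x + y) = rin z x + rin z y.
Proof. by rewrite /rin innerDr raddfD. Qed.

Lemma rinNl x y : rin (- x) y = - rin x y.
Proof. by rewrite /rin innerNl raddfN. Qed.

Lemma rinNr x y : rin x (- y) = - rin x y.
Proof. by rewrite /rin innerNr raddfN. Qed.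

Lemma rin0l x : rin 0 x = 0. Proof. by rewrite /rin inner0l. Qed.
Lemma rin0r x : rin x 0 = 0. Proof. by rewrite /rin inner0r. Qed.

Lemma rinZl (a : R) x z : rin (a%:C *: x) z = a * rin x z.
Proof.
by rewrite /rin innerZl; case: (inner x z) => u v /=; rewrite mul0r subr0.
Qed.

Lemma rinZr (a : R) x z : rin z (a%:C *: x) = a * rin z x.
Proof. by rewrite rinC rinZl rinC. Qed.

Lemma sqZ (a : R) x : sq (a%:C *: x) = a ^+ 2 * sq x.
Proof. by rewrite /sq rinZl rinZr mulrA expr2. Qed.

Definition rinE := (rinDl, rinDr, rinNl, rinNr, rinZl, rinZr, rin0l, rin0r).

Lemma sqD x y : sq (x + y) = sq x + 2 * rin x y + sq y.
Proof. by rewrite /sq !rinE (rinC y x); ring. Qed.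

Lemma sqB x y : sq (x - y) = sq x - 2 * rin x y + sq y.
Proof. by rewrite /sq !rinE (rinC y x); ring. Qed.

Lemma sqN x : sq (- x) = sq x.
Proof. by rewrite /sq !rinE opprK. Qed.

Lemma inner_ext x y : (forall z, inner z x = inner z y) -> x = y.
Proof.
move=> h; apply/eqP; rewrite -subr_eq0 -sq_eq0; apply/eqP.
by rewrite /sq /rin innerDr innerNr h subrr.
Qed.

Lemma rin_ext x y : (forall z, rin z x = rin z y) -> x = y.
Proof.
move=> h; apply/eqP; rewrite -subr_eq0 -sq_eq0; apply/eqP.
by rewrite /sq rinDr rinNr h subrr.
Qed.

Lemma rinZC (a : R[i]) x z : rin (a *: x) z = rin x (a^* *: z).
Proof. by rewrite /rin innerZl innerZr conjCK. Qed.

(** The squared norm of |y|^2 x - Re <x, y> y is nonnegative. *)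
Lemma cauchy_schwarz x y : rin x y ^+ 2 <= sq x * sq y.
Proof.
have [->|y0] := eqVneq y 0; first by rewrite /sq !rin0r expr0n/= mulr0.
have y1 : 0 < sq y by rewrite sq_gt0.
have := sq_ge0 ((sq y)%:C *: x - (rin x y)%:C *: y).
rewrite sqB !sqZ !rinE => h.
suff : 0 <= sq y * (sq x * sq y - rin x y ^+ 2).
  by rewrite pmulr_rge0// subr_ge0.
by apply: (le_trans h); rewrite le_eqVlt; apply/orP; left; apply/eqP; ring.
Qed.

Lemma norm_leM x (y : R) : 0 <= y -> (`|x| <= y%:C) = (sq x <= y ^+ 2).
Proof.
move=> y0; rewrite norm_sq lecR -[X in _ <= X]ger0_norm// -sqrtr_sqr.
by rewrite ler_sqrt// exprn_ge0.
Qed.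

(** Completeness, with limits expressed through squared real norms. *)
Lemma cauchy_sq_converges (u : nat -> V) :
  (forall e : R, 0 < e -> exists N, forall n m, (N <= n)%N -> (N <= m)%N ->
    sq (u n - u m) <= e) ->
  exists l, forall e : R, 0 < e -> exists N, forall n, (N <= n)%N ->
    sq (u n - l) <= e.
Proof.
move=> hu.
have : cvg (u n @[n --> \oo])%classic.
  apply/cauchy_cvgP; apply/cauchy_ballP => e e0; near_simpl.
  have e1 : e = (complex.Re e)%:C by rewrite complex_rc_reK// ltW.
  have e2 : 0 < complex.Re e by rewrite -ltcR -e1.
  have e3 : 0 < complex.Re e / 2 by rewrite divr_gt0.
  have [N hN] := hu ((complex.Re e / 2) ^+ 2) (exprn_gt0 _ e3).
  have key n m : (N <= n)%N -> (N <= m)%N -> `|u n - u m| < e.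
    move=> Nn Nm; apply: (@le_lt_trans _ _ (complex.Re e / 2)%:C).
      by rewrite norm_leM; [exact: hN|exact: ltW].
    by rewrite e1 ltcR /=; lra.
  exists ([set n | (N <= n)%N], [set n | (N <= n)%N])%classic => /=.
    by split; exists N.
  by case=> n m /= [Nn Nm]; rewrite -ball_normE /=; exact: key.
move=> /cvg_ex[l /cvgrPdist_le ul]; exists l => e e0.
have e1 : 0 <= Num.sqrt e by rewrite sqrtr_ge0.
have /ul[N _ hN] : 0 < (Num.sqrt e)%:C by rewrite ltcR sqrtr_gt0.
exists N => n Nn; have := hN n Nn.
by rewrite /= distrC norm_leM// sqr_sqrtr// ltW.
Qed.

End InnerProduct.

(** * Riesz representation and adjoints *)

(** With z = f^† y and x = f z, a bound for f becomes one for its adjoint. *)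
Lemma sq_le_of_rin (R : realType) (U V : hilbertType R) (x y : V) (z : U)
    (c : R) :
  sq z = rin x y -> sq x <= c * sq z -> 0 <= c -> sq z <= c * sq y.
Proof.
move=> zE xc c0; have := cauchy_schwarz x y; rewrite -zE => h.
have [s0|s0] := eqVneq (sq z) 0; first by rewrite s0 mulr_ge0 ?sq_ge0.
have s1 : 0 < sq z by rewrite lt_def s0 sq_ge0.
rewrite -(ler_pM2l s1) -expr2 (le_trans h)// mulrA ler_wpM2r ?sq_ge0//.
by rewrite mulrC.
Qed.

Lemma additive_bounded_continuous (F : numFieldType) (V W : normedModType F)
    (f : V -> W) (M : F) :
  (forall x y, f (x - y) = f x - f y) -> (forall x, `|f x| <= M * `|x|) ->
  continuous f.
Proof.
move=> fB fM x.
have M0 : 0 < `|M| + 1 by rewrite ltr_wpDl.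
apply/(@cvgrPdist_lt _ _ _ (nbhs x)) => e e0; near=> y.
rewrite -fB (le_lt_trans (fM _))//.
apply: (@le_lt_trans _ _ ((`|M| + 1) * `|x - y|)).
  have [->|xy] := eqVneq (x - y) 0; first by rewrite normr0 !mulr0.
  have xy0 : 0 < `|x - y| by rewrite normr_gt0.
  have Mr : 0 <= M.
    by have := le_trans (normr_ge0 _) (fM (x - y)); rewrite pmulr_lge0.
  by rewrite ler_wpM2r// ger0_norm// lerDl.
rewrite -ltr_pdivlMl//; near: y.
by apply: cvgr_dist_lt; [exact: cvg_id|rewrite mulr_gt0 ?invr_gt0].
Unshelve. all: by end_near. Qed.

(** The real-linear functional g is represented by the minimizer of
    Q(x) = |x|^2 - 2 g(x), whose first-order condition is g = <., b>. The
    hypothesis on d says that Q is bounded below; minimizing sequences are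
    Cauchy by the parallelogram law, and the first-order condition passes to
    their limit in an approximate form. *)
Lemma riesz_rin (R : realType) (V : hilbertType R) (g : V -> R) (d : R) :
  (forall x y, g (x + y) = g x + g y) ->
  (forall (a : R) x, g (a%:C *: x) = a * g x) ->
  (forall x, 2 * g x <= sq x + d) ->
  exists b, forall x, g x = rin x b.
Proof.
move=> gD gZ gd.
pose Q x := sq x - 2 * g x.
have Qd x : - d <= Q x by have := gd x; rewrite /Q; lra.
pose A := [set Q x | x in [set: V]]%classic.
have Ainf : has_inf A.
  by split; [exists (Q 0); exists 0|exists (- d) => _ [x _ <-]].
pose m := inf A.
have mQ x : m <= Q x by apply: ge_inf; [case: Ainf|exists x].
have Qm (e : R) : 0 < e -> exists x, Q x < m + e.
  by move=> e0; have [_ [x _ <-] h] := inf_adherent e0 Ainf; exists x.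
(* otherwise the step t below would decrease Q by more than e *)
have near_crit (e : R) x h : Q x < m + e ->
    (rin x h - g h) ^+ 2 <= e * sq h.
  move=> xe.
  have [h0|h0] := eqVneq h 0.
    have g0 : g 0 = 0 by have := gZ 0 0; rewrite mul0r scaler0.
    by rewrite h0 rin0r g0 /sq rin0r subrr expr0n/= mulr0.
  have s0 : 0 < sq h by rewrite sq_gt0.
  pose t := - (rin x h - g h) / sq h.
  have := mQ (x + t%:C *: h).
  rewrite /Q sqD sqZ gD gZ rinE => mt.
  have tE : t * sq h = - (rin x h - g h) by rewrite /t divfK// gt_eqF.
  have : t * (rin x h - g h) + e >= 0.
    move: xe mt; rewrite /Q expr2 -[t * t * _]mulrA tE; lra.
  move/mulr_ge0 => /(_ _ (ltW s0)).
  by rewrite mulrDl mulrAC tE mulNr -expr2; lra.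
(* parallelogram law at the midpoint of x and y *)
have Qpar x y : sq (x - y) <= 2 * (Q x - m) + 2 * (Q y - m).
  have := mQ ((2^-1)%:C *: (x + y)).
  by rewrite /Q sqZ gZ gD sqB sqD; lra.
have [u hu] : {u : nat -> V & forall n, Q (u n) < m + n.+1%:R^-1}.
  apply: (@choice _ _ (fun n x => Q x < m + n.+1%:R^-1)) => n.
  by apply: Qm; rewrite invr_gt0.
have inv_small (e : R) : 0 < e -> exists N, forall n, (N <= n)%N ->
    n.+1%:R^-1 <= e.
  move=> e0; exists (Num.truncn e^-1) => n Nn.
  rewrite -[leRHS]invrK lef_pV2 ?posrE ?invr_gt0//.
  rewrite (le_trans (ltW (truncnS_gt _)))// ler_nat.
  by [].
have [e e0|b hb] := @cauchy_sq_converges R V u.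
  have [N hN] := inv_small (e / 4) (divr_gt0 e0 (ltr0Sn _ 3)).
  exists N => n k /hN n1 /hN k1; have := Qpar (u n) (u k).
  move: n1 k1 (hu n) (hu k).
  by move: (n.+1%:R^-1) (k.+1%:R^-1) => r1 r2; lra.
exists b => h; apply/eqP; rewrite -subr_eq0 -sqrf_eq0 eq_le sqr_ge0 andbT.
apply/ler_addgt0Pl => e e0; rewrite addr0.
have s1 : 0 < 4 * (sq h + 1) by have := sq_ge0 h; lra.
have e1 : 0 < e / (4 * (sq h + 1)) by rewrite divr_gt0.
have [N hN] := hb _ e1; have [N' hN'] := inv_small _ e1.
pose n := maxn N N'.
have := hN n (leq_maxl _ _); have := hN' n (leq_maxr _ _) => k1 k2.
have := near_crit _ _ h (hu n); have := cauchy_schwarz (u n - b) h.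
rewrite !rinE.
have e2 : e / (4 * (sq h + 1)) * sq h <= e / 4.
  have E : e / 4 = e / (4 * (sq h + 1)) * (sq h + 1).
    by field; apply/eqP; have := sq_ge0 h; lra.
  by rewrite E ler_pM2l//; lra.
have := ler_wpM2r (sq_ge0 h) k1; have := ler_wpM2r (sq_ge0 h) k2.
move: e2; rewrite (rinC h b); move: (rin (u n) h) (rin b h) (g h) => p q r.
move: (_ / _ * _) (sq _ * _) (_^-1 * _) => A1 A2 A3 h1 h2 h3 h4 h5.
by have := sqr_ge0 (2 * p - q - r); lra.
Qed.

Section Adjoint.
Context {R : realType} {H K : hilbertType R}.

Lemma bounded_sq (V W : hilbertType R) (f : bounded_op V W) :
  exists2 m : R, 0 <= m & forall x, sq (f x) <= m ^+ 2 * sq x.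
Proof.
have [M M0 hM] := bounded_op_bound f.
have E : M = (complex.Re M)%:C by rewrite complex_rc_reK.
have m0 : 0 <= complex.Re M by rewrite -lecR -E.
exists (complex.Re M) => // x; rewrite -lecR rmorphM/= -!inner_sq !inner_normE.
by rewrite rmorphXn/= -E -exprMn lerXn2r ?nnegrE ?mulr_ge0.
Qed.

Lemma opnorm_sq (V W : hilbertType R) (f : bounded_op V W) (m : R) :
  0 <= m -> `|f| <= m%:C <-> forall x, sq (f x) <= m ^+ 2 * sq x.
Proof.
move=> m0; have E x : (sq (f x) <= m ^+ 2 * sq x) = (`|f x| <= m%:C * `|x|).
  rewrite [`|x|]norm_sq -rmorphM/= norm_leM ?mulr_ge0 ?sqrtr_ge0//.
  by rewrite exprMn sqr_sqrtr ?sq_ge0.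
split=> [fm x|fm]; rewrite ?E.
  by apply: (le_trans (le_opnorm f x)); rewrite ler_wpM2r.
by apply: opnorm_le => [|x]; [rewrite lecR|rewrite -E].
Qed.

Lemma bounded_op_of_sq (V W : hilbertType R) (f : V -> W) (m : R) :
  0 <= m -> linear f -> (forall x, sq (f x) <= m ^+ 2 * sq x) ->
  exists g : bounded_op V W, g =1 f.
Proof.
move=> m0 lf fm.
suff fc : f \in @continuous_linear R R[i] V W by exists (BoundedOp fc).
apply/asboolP; split=> //; apply: (@additive_bounded_continuous _ _ _ _ m%:C).
  by move=> x y; have := lf (-1) y x; rewrite !scaleN1r ![- _ + _]addrC.
move=> x; rewrite [`|x|]norm_sq -rmorphM/= norm_leM ?mulr_ge0 ?sqrtr_ge0//.
by rewrite exprMn sqr_sqrtr ?sq_ge0.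
Qed.

(** Riesz is applied to the real parts; replacing x by i x gives the complex
    identity. *)
Lemma adjoint_exists (a : bounded_op H K) : exists b : bounded_op K H,
  forall (x : H) (y : K), inner (a x) y = inner x (b y).
Proof.
have [m m0 am] := bounded_sq a.
have ex y : exists b, forall x, rin (a x) y = rin x b.
  apply: (@riesz_rin _ _ _ (m ^+ 2 * sq y)) => [x x'|r x|x].
  - by rewrite linearD rinDl.
  - by rewrite linearZ rinZl.
  (* |a x - m^2 y|^2 >= 0 bounds the functional when m <> 0 *)
  - have [m1|m1] := eqVneq m 0.
      move: (am x); rewrite m1 expr0n/= !mul0r => a0.
      have /sq0P -> : sq (a x) = 0 by apply/eqP; rewrite eq_le a0 sq_ge0.
      by rewrite rin0l mulr0 addr0 sq_ge0.
    have m2 : 0 < m by rewrite lt_def m1.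
    have := sq_ge0 (a x - (m ^+ 2)%:C *: y); rewrite sqB sqZ rinE.
    have m3 : 0 < m ^+ 2 by rewrite exprn_gt0.
    move=> h; rewrite -(ler_pM2l m3); have := am x; move: h.
    by rewrite mulrDr [m ^+ 2 * (m ^+ 2 * _)]mulrA -expr2; lra.
have [b hb] := choice ex.
have hbi y x : inner (a x) y = inner x (b y).
  apply/eqP; rewrite eq_complex; apply/andP; split; apply/eqP; first exact: hb.
  have := hb y ('i *: x); rewrite linearZ /rin !innerZl.
  by case: (inner (a x) y) => ? ?; case: (inner x (b y)) => ? ? /=; lra.
have lb : linear b.
  by move=> k y z; apply: inner_ext => x; rewrite innerDr innerZr -!hbi
     innerDr innerZr.
have bm y : sq (b y) <= m ^+ 2 * sq y.
  apply: (sq_le_of_rin (x := a (b y))) => //; exact: exprn_ge0.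
have [g hg] := bounded_op_of_sq m0 lb bm.
by exists g => x y; rewrite hg hbi.
Qed.

Lemma adjointP (a : bounded_op H K) x y :
  inner (a x) y = inner x (adjoint a y).
Proof.
have [b hb] := adjoint_exists a.
by rewrite /adjoint; case: xgetP => [c _ /= -> //|/(_ b hb)].
Qed.

End Adjoint.

Local Notation "a ^†" := (adjoint a) (at level 2, format "a ^†").

(** * Adjoints and the triple product *)

Section AdjointTheory.
Context {R : realType}.

Lemma op_ext (V W : hilbertType R) (f g : bounded_op V W) :
  (forall x, f x = g x) -> f = g.
Proof. by move=> fg; apply/val_inj/funext. Qed.

Lemma opD (V W : hilbertType R) (f g : bounded_op V W) x :
  (f + g) x = f x + g x.
Proof. by []. Qed.

Lemma opN (V W : hilbertType R) (f : bounded_op V W) x : (- f) x = - f x.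
Proof. by []. Qed.

Lemma opZ (V W : hilbertType R) (k : R[i]) (f : bounded_op V W) x :
  (k *: f) x = k *: f x.
Proof. by []. Qed.

Lemma op_sum (V W : hilbertType R) I (s : seq I) (F : I -> bounded_op V W) x :
  (\sum_(i <- s) F i) x = \sum_(i <- s) F i x.
Proof. by elim/big_rec2: _ => // i y f _ <-; rewrite opD. Qed.

Definition opE := (opD, opN, opZ).

Context {V W : hilbertType R}.
Implicit Types a b c : bounded_op V W.

Lemma adjointPr a x y : inner y (a x) = inner (a^† y) x.
Proof. by rewrite innerC adjointP [RHS]innerC. Qed.

Lemma rin_adj a x y : rin (a x) y = rin x (a^† y).
Proof. by rewrite /rin adjointP. Qed.

Lemma rin_adjr a x y : rin y (a x) = rin (a^† y) x.
Proof. by rewrite /rin adjointPr. Qed.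

Lemma adjoint_unique a (b : bounded_op W V) :
  (forall x y, inner (a x) y = inner x (b y)) -> a^† = b.
Proof.
by move=> ab; apply: op_ext => y; apply: inner_ext => x; rewrite -ab adjointP.
Qed.

Lemma adjointD a b : (a + b)^† = a^† + b^†.
Proof.
by apply: adjoint_unique => x y; rewrite !opE innerDl innerDr !adjointP.
Qed.

Lemma adjointZ k a : (k *: a)^† = k^* *: a^†.
Proof.
apply: adjoint_unique => x y.
by rewrite !opE innerZl innerZr adjointP conjCK.
Qed.

Lemma adjointN a : (- a)^† = - a^†.
Proof.
by apply: adjoint_unique => x y; rewrite !opE innerNl innerNr adjointP.
Qed.

Lemma adjoint0 : (0 : bounded_op V W)^† = 0.
Proof. by apply: adjoint_unique => x y; rewrite inner0l inner0r. Qed.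

End AdjointTheory.

Lemma adjointK (R : realType) (V W : hilbertType R) (a : bounded_op V W) :
  a^†^† = a.
Proof. by apply: adjoint_unique => x y; rewrite adjointPr. Qed.

Section Triple.
Context {R : realType} {V W : hilbertType R}.
Implicit Types a b c : bounded_op V W.
Local Notation t := (@cartan_triple R V W).

Lemma tripleE a b c x :
  t a b c x = 2^-1 *: (a (b^† (c x)) + c (b^† (a x))).
Proof. by []. Qed.

Lemma adjoint_triple a b c x :
  (t a b c)^† x = 2^-1 *: (a^† (b (c^† x)) + c^† (b (a^† x))).
Proof.
apply: inner_ext => z; rewrite -adjointP tripleE innerZl innerZr !innerDl.
rewrite !innerDr !adjointP adjointK; congr (_ * _); last exact: addrC.
by rewrite fmorphV rmorph_nat.
Qed.

(** * Partial isometries and the geometry of the unit ball *)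

Definition contraction (U U' : hilbertType R) (f : bounded_op U U') :=
  forall x, sq (f x) <= sq x.

Lemma contractionP (U U' : hilbertType R) (f : bounded_op U U') :
  `|f| <= 1 <-> contraction f.
Proof.
have := @opnorm_sq R U U' f 1 ler01; rewrite expr1n rmorph1 => ->.
by split=> h x; have := h x; rewrite mul1r.
Qed.

Lemma adjoint_le (U U' : hilbertType R) (f : bounded_op U U') (c : R) :
  0 <= c -> (forall x, sq (f x) <= c * sq x) ->
  forall y, sq (f^† y) <= c * sq y.
Proof.
move=> c0 fc y; apply: (sq_le_of_rin (x := f (f^† y))) => //.
by rewrite rin_adj.
Qed.

Lemma adjoint_contraction (U U' : hilbertType R) (f : bounded_op U U') :
  contraction f -> contraction f^†.
Proof.
move=> fc y; rewrite -[leRHS]mul1r; apply: adjoint_le => // x.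
by rewrite mul1r.
Qed.

(** These are the partial isometries. *)
Definition tripotent (U U' : hilbertType R) (u : bounded_op U U') :=
  forall x, u (u^† (u x)) = u x.

Lemma tripotentVK (U U' : hilbertType R) (u : bounded_op U U') :
  tripotent u -> forall y, u^† (u (u^† y)) = u^† y.
Proof.
move=> ut y; apply: inner_ext => x.
by rewrite -adjointP adjointPr -adjointP ut adjointP.
Qed.

Lemma tripotent_adj (U U' : hilbertType R) (u : bounded_op U U') :
  tripotent u -> tripotent u^†.
Proof. by move=> ut y; rewrite adjointK tripotentVK. Qed.

(** Right orthogonality: the initial spaces are orthogonal. *)
Definition rorth (U U' : hilbertType R) (a b : bounded_op U U') :=
  forall x, a (b^† x) = 0.

(** Orthogonality of initial spaces and of ranges. *)
Definition orth a b := rorth a b /\ rorth a^† b^†.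

Lemma rorth_sym (U U' : hilbertType R) (a b : bounded_op U U') :
  rorth a b -> rorth b a.
Proof.
move=> ab x; apply: inner_ext => y.
by rewrite adjointPr -adjointP ab inner0l inner0r.
Qed.

Lemma orth_sym a b : orth a b -> orth b a.
Proof. by move=> [h k]; split; exact: rorth_sym. Qed.

(** On h in the initial space of u, |u h| = |h|, and the parallelogram law for
    (u + y) h and (u - y) h leaves no room for y h. *)
Lemma parallelogram_rorth (U U' : hilbertType R) (u y : bounded_op U U') :
  tripotent u -> contraction (u + y) -> contraction (u - y) -> rorth y u.
Proof.
move=> ut up um k; set h := u^† k.
have uh : sq (u h) = sq h by rewrite /sq rin_adj /h tripotentVK.
have := up h; have := um h; rewrite !opE sqB sqD uh => h1 h2.
apply/sq0P/eqP; rewrite eq_le sq_ge0 andbT.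
by move: h1 h2; move: (sq _) (sq _) (rin _ _) => ? ? ?; lra.
Qed.

Lemma orth_of_contraction u y :
  tripotent u -> contraction (u + y) -> contraction (u - y) -> orth y u.
Proof.
move=> ut up um; split; first exact: parallelogram_rorth.
apply: parallelogram_rorth; first exact: tripotent_adj.
  by rewrite -adjointD; exact: adjoint_contraction.
by rewrite -adjointN -adjointD; exact: adjoint_contraction.
Qed.

(** The vector h splits into its component p = u^† u h, on which y vanishes, and
    q = h - p, on which u vanishes; the images are orthogonal. *)
Lemma contraction_orth_sum u y :
  tripotent u -> orth y u -> contraction y -> contraction (u + y).
Proof.
move=> ut [yu uy] yc h.
pose p := u^† (u h); pose q := h - p.
have up : u p = u h by rewrite /p ut.
have yq : y h = y q by rewrite /q linearB/= yu subr0.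
have o1 : rin (u h) (y h) = 0.
  by rewrite rinC rin_adj (_ : y^† (u h) = 0) ?rin0r// -[u]adjointK uy.
have o2 : rin p q = 0 by rewrite /q rinC /p -rin_adj linearB/= ut subrr rin0l.
have sp : sq (u h) = sq p by rewrite -up /sq rin_adj /p tripotentVK.
have -> : sq h = sq p + sq q.
  have -> : h = p + q by rewrite /q addrC subrK.
  by rewrite sqD o2 mulr0 addr0.
by rewrite opD sqD o1 mulr0 addr0 sp yq lerD2l.
Qed.

Definition cube (a : bounded_op V W) := t a a a.

Lemma cube_triple a : cube a = t a a a. Proof. by []. Qed.

Lemma triple_diagE a b x : t a b a x = a (b^† (a x)).
Proof.
by rewrite tripleE -mulr2n -[X in _ *: X]scaler_nat scalerA mulVf ?scale1r.
Qed.

Lemma cubeE a x : cube a x = a (a^† (a x)). Proof. exact: triple_diagE. Qed.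

Lemma cube_tripotent u : tripotent u <-> cube u = u.
Proof.
split=> [ut|h x]; last by rewrite -cubeE h.
by apply: op_ext => x; rewrite cubeE ut.
Qed.

(** Inequalities between polynomials in the positive contraction A = v^† v are
    inequalities between the moments m_k = <A^k h, h>, namely m_0 = |h|^2,
    m_1 = |v h|^2, m_2 = |g|^2 and m_3 = |v g|^2 with g = A h. *)
Section Moments.
Variables (v : bounded_op V W) (h : V).
Hypothesis vc : contraction v.
Let g := v^† (v h).

Lemma moment1 : sq (v h) <= sq h. Proof. exact: vc. Qed.

Lemma moment2 : sq g <= sq (v h). Proof. exact: adjoint_contraction. Qed.

Lemma moment3 : sq (v g) <= sq g. Proof. exact: vc. Qed.

Lemma moment_rin : rin (v h) (v g) = sq g.
Proof. by rewrite rinC rin_adj. Qed.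

(** This is 4 - 9 A + 6 A^2 - A^3 = (1 - A)^2 (4 - A) >= 0. *)
Lemma moment_polynomial :
  0 <= 4 * sq h - 9 * sq (v h) + 6 * sq g - sq (v g).
Proof.
have gh : rin h g = sq (v h) by rewrite /sq [RHS]rin_adj.
have := vc (h - g); have := sq_ge0 (h - g).
rewrite linearB/= !sqB gh moment_rin.
by move: (sq h) (sq (v h)) (sq g) (sq (v g)) => m0 m1 m2 m3; lra.
Qed.

End Moments.

(** The defect vanishes exactly on partial isometries, and it is the direction
    in which the norm detects that a contraction is not one of them. *)
Definition defect (a : bounded_op V W) := a - cube a.

Lemma defectE a x : defect a x = a x - a (a^† (a x)).
Proof. by rewrite opD opN cubeE. Qed.

(** On a singular value s in [0, 1] this says that s (3 - s^2) / 2 and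
    s (1 + s^2) / 2 are at most 1. *)
Lemma contraction_add_defect v : contraction v ->
  contraction (v + (2^-1)%:C *: defect v) /\
  contraction (v - (2^-1)%:C *: defect v).
Proof.
move=> vc; split=> h; set g := v^† (v h).
  rewrite opD opZ defectE sqD !rinE sqZ sqB moment_rin -/g -/(sq (v h)).
  have := moment_polynomial h vc; rewrite -/g.
  by move: (sq h) (sq (v h)) (sq g) (sq (v g)) => m0 m1 m2 m3; lra.
rewrite opD opN opZ defectE sqB !rinE sqZ sqB moment_rin -/g -/(sq (v h)).
have := moment1 h vc; have := moment2 h vc; have := moment3 h vc.
rewrite -/g; move: (sq h) (sq (v h)) (sq g) (sq (v g)) => m0 m1 m2 m3; lra.
Qed.

(** In moments: |d|^2 = m_1 - 2 m_2 + m_3 <= m_1 - m_2 = <v h, d>, where d is the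
    value at h of the defect of v. *)
Lemma sq_add_defect v (r : R) h : contraction v -> 0 <= r ->
  (2 * r + r ^+ 2) * sq (defect v h) <= sq ((v + r%:C *: defect v) h).
Proof.
move=> vc r0; set g := v^† (v h).
rewrite [in leRHS]opD [in leRHS]opZ !defectE (sqD (v h) (_ *: _)) !rinE.
rewrite sqZ !sqB moment_rin.
rewrite -/g -/(sq (v h)).
have := moment3 h vc; rewrite -/g; have := sq_ge0 (v h).
move: (sq (v h)) (sq g) (sq (v g)) => m1 m2 m3 m1_ge0.
rewrite -subr_ge0 => /(mulr_ge0 r0); lra.
Qed.

End Triple.

(** * Conjugations preserve partial isometries *)

Section Conjugation.
Context {R : realType} {V W : hilbertType R}.
Variable tau : conjugation (bounded_op V W).
Local Notation t := (@cartan_triple R V W).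
Implicit Types a b c : bounded_op V W.

Lemma tauD a b : tau (a + b) = tau a + tau b.
Proof.
by have := conjugation_conjlinear tau 1 a b; rewrite rmorph1 !scale1r.
Qed.

Lemma tau0 : tau 0 = 0.
Proof. by apply: (addrI (tau 0)); rewrite -tauD !addr0. Qed.

Lemma tauZ k a : tau (k *: a) = k^* *: tau a.
Proof. by have := conjugation_conjlinear tau k a 0; rewrite tau0 !addr0. Qed.

Lemma tauN a : tau (- a) = - tau a.
Proof. by rewrite -scaleN1r tauZ rmorphN1 scaleN1r. Qed.

Lemma conj_real (r : R) : (r%:C)^* = r%:C :> R[i].
Proof. by apply: CrealP; apply/complex_realP; exists r. Qed.

Lemma tauZr (r : R) a : tau (r%:C *: a) = r%:C *: tau a.
Proof. by rewrite tauZ conj_real. Qed.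

Lemma tau_sum I (s : seq I) (F : I -> bounded_op V W) :
  tau (\sum_(i <- s) F i) = \sum_(i <- s) tau (F i).
Proof. by apply: big_morph; [exact: tauD|exact: tau0]. Qed.

Lemma tau_contraction a : contraction a -> contraction (tau a).
Proof. by rewrite -!contractionP conjugation_isometry. Qed.

Lemma tripotent_contraction (U U' : hilbertType R) (u : bounded_op U U') :
  tripotent u -> contraction u.
Proof.
move=> ut; rewrite -[u]addr0; apply: contraction_orth_sum => //.
  by split=> x; rewrite ?adjoint0//.
by move=> x; rewrite /sq rin0l sq_ge0.
Qed.

(** Both u + v and u - v are contractions, which is a property of the norm. *)
Lemma tau_orth u v : tripotent (tau u) -> tripotent u -> tripotent v ->
  orth v u -> orth (tau v) (tau u).
Proof.
move=> tu ut vt vu; have vc := tripotent_contraction vt.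
apply: orth_of_contraction => //; rewrite -?tauN -tauD; apply: tau_contraction.
  exact: contraction_orth_sum.
apply: contraction_orth_sum => //; last by move=> x; rewrite opN sqN.
case: vu => [h k]; split=> x; first by rewrite opN h oppr0.
by rewrite adjointN opN k oppr0.
Qed.

(** Let v = tau u and let d be the defect of v. As v + d/2 and v - d/2 are
    contractions, so are their images under tau, hence tau d is orthogonal to u;
    then u + tau (r d), and therefore v + r d, is a contraction for
    r = 1 / |d|. But |v + r d|^2 >= (2 r + r^2) |d|^2 = 2 |d| + 1. *)
Lemma tau_tripotent u : tripotent u -> tripotent (tau u).
Proof.
move=> ut; set v := tau u.
have vc : contraction v by exact/tau_contraction/tripotent_contraction.
have [vp vm] := contraction_add_defect vc.
have tauv : tau v = u by rewrite /v conjugation_involutive.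
have yu : orth (tau (defect v)) u.
  have : orth (tau ((2^-1)%:C *: defect v)) u.
    apply: orth_of_contraction => //; rewrite -tauv -?tauN -tauD;
      exact: tau_contraction.
  rewrite tauZr => -[h k].
  have n0 : (2^-1)%:C != 0 :> R[i] by rewrite (inj_eq (@complexI R)) invr_eq0.
  split=> x; apply: (scalerI n0); rewrite scaler0.
    by rewrite -opZ h.
  by have := k x; rewrite adjointZ conj_real opZ.
apply/cube_tripotent/eqP; rewrite eq_sym -subr_eq0 -/(defect v).
rewrite -normr_eq0; apply/negPn/negP => y0.
have [N NE] : exists N : R, `|defect v| = N%:C.
  by exists (complex.Re `|defect v|); rewrite complex_rc_reK// normr_ge0.
have N0 : 0 < N by rewrite -ltcR -NE lt_def y0 normr_ge0.
pose r := N^-1; have r0 : 0 < r by rewrite invr_gt0.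
have cr : contraction (v + r%:C *: defect v).
  have -> : v + r%:C *: defect v = tau (u + tau (r%:C *: defect v)).
    by rewrite tauD conjugation_involutive.
  apply: tau_contraction; apply: contraction_orth_sum => //.
    rewrite tauZr; case: yu => h k; split=> x; first by rewrite opZ h scaler0.
    by rewrite adjointZ opZ k scaler0.
  apply: tau_contraction; rewrite -contractionP normrZ NE -[1]/((1 : R)%:C).
  have -> : `|r%:C| = r%:C :> R[i] by rewrite ger0_norm// lecR ltW.
  by rewrite -rmorphM/= /r mulVf// gt_eqF.
have s0 : 0 < 2 * r + r ^+ 2 by rewrite addr_gt0 ?mulr_gt0// exprn_gt0.
have s1 : 0 <= (2 * r + r ^+ 2)^-1 by rewrite invr_ge0 ltW.
have : `|defect v| <= (Num.sqrt (2 * r + r ^+ 2)^-1)%:C.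
  apply/opnorm_sq; first exact: sqrtr_ge0.
  move=> x; rewrite sqr_sqrtr// ler_pdivlMl//.
  exact: le_trans (sq_add_defect x vc (ltW r0)) (cr x).
rewrite NE lecR -ler_sqr ?nnegrE ?sqrtr_ge0//; last exact: ltW.
rewrite sqr_sqrtr// -(ler_pM2r s0) mulVf; last exact: lt0r_neq0.
have -> : N ^+ 2 * (2 * r + r ^+ 2) = 2 * N + 1.
  by rewrite /r; field; exact: lt0r_neq0.
by rewrite leNgt => /negP; apply; lra.
Qed.

End Conjugation.

(** * Orthonormal families and the spectral theorem *)

Definition rcons_fun (T : Type) (e : nat -> T) (k : nat) (v : T) i :=
  if i == k then v else e i.

Section FiniteDimension.

(** More vectors than coordinates: the kernel of the matrix is nonzero. *)
Lemma linear_dependence (F : fieldType) (I : finType) (n : nat)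
    (f : 'I_n -> I -> F) : (#|I| < n)%N ->
  exists g : 'I_n -> F, (exists i, g i != 0) /\
    forall j, \sum_(i < n) g i * f i j = 0.
Proof.
move=> In; pose M := \matrix_(i < n, j < #|I|) f i (enum_val j).
have : kermx M != 0.
  by rewrite kermx_eq0 -row_leq_rank -ltnNge (leq_ltn_trans (rank_leq_col M)).
case/rowV0Pn => v /sub_kermxP vM /rV0Pn[i vi].
exists (v 0); split; first by exists i.
move=> j; have /rowP/(_ (enum_rank j)) := vM; rewrite !mxE => {2}<-.
by apply: eq_bigr => k _; rewrite mxE enum_rankK.
Qed.

Context {R : realType} {V : hilbertType R}.

(** Families are sequences of which only the first k terms matter, so that they
    can be extended without changing the index type. *)
Definition orthonormal (e : nat -> V) (k : nat) :=
  forall i j, (i < k)%N -> (j < k)%N -> inner (e i) (e j) = (i == j)%:R.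

Definition spanning (e : nat -> V) (k : nat) :=
  forall x, x = \sum_(i < k) inner x (e i) *: e i.

Lemma orthogonal_vector_exists (e : nat -> V) (k : nat) :
  orthonormal e k -> ~ spanning e k ->
  exists2 r, r != 0 & forall i, (i < k)%N -> inner r (e i) = 0.
Proof.
move=> oe /existsNP[x /eqP]; rewrite -subr_eq0 => r0.
exists (x - \sum_(i < k) inner x (e i) *: e i) => // i ik.
rewrite innerDl innerNl inner_suml (bigD1 (Ordinal ik))//= innerZl oe// eqxx.
rewrite mulr1 big1 ?addr0 ?subrr// => j /negbTE ji.
by rewrite innerZl oe// (_ : (nat_of_ord j == i) = false) ?mulr0.
Qed.

Lemma unit_multiple_exists (r : V) : r != 0 -> exists2 a : R[i], a != 0 &
  inner (a *: r) (a *: r) = 1.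
Proof.
move=> r0; have s0 : 0 < sq r by rewrite sq_gt0.
have q0 : 0 < Num.sqrt (sq r) by rewrite sqrtr_gt0.
exists ((Num.sqrt (sq r))^-1)%:C.
  by rewrite (inj_eq (@complexI R)) invr_eq0 gt_eqF.
by rewrite inner_sq sqZ exprVn sqr_sqrtr ?sq_ge0// mulVf// gt_eqF.
Qed.

Lemma orthonormal_rcons (e : nat -> V) (k : nat) (v : V) :
  orthonormal e k -> inner v v = 1 ->
  (forall i, (i < k)%N -> inner v (e i) = 0) ->
  orthonormal (rcons_fun e k v) k.+1.
Proof.
move=> oe vv ve i j; rewrite !ltnS /rcons_fun => ik jk.
have [ik'|ik'] := boolP (i == k); have [jk'|jk'] := boolP (j == k).
- by rewrite (eqP ik') (eqP jk') eqxx.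
- by rewrite (eqP ik') eq_sym (negbTE jk') ve// ltn_neqAle jk'.
- by rewrite (eqP jk') (negbTE ik') innerC ve ?rmorph0// ltn_neqAle ik'.
- by rewrite oe// ltn_neqAle ?ik' ?jk'.
Qed.

Lemma orthonormal_exists (k : nat) :
  ~ finite_dimensional V -> exists e, orthonormal e k.
Proof.
move=> Vinf; elim: k => [|k [e oe]]; first by exists (fun=> 0).
have [r r0 re] : exists2 r, r != 0 & forall i, (i < k)%N -> inner r (e i) = 0.
  apply: orthogonal_vector_exists => // ce; apply: Vinf.
  exists k, (fun i : 'I_k => e i) => v.
  by exists (fun i => inner v (e i)); exact: ce.
have [a a0 ra] := unit_multiple_exists r0.
exists (rcons_fun e k (a *: r)); apply: orthonormal_rcons => // i ik.
by rewrite innerZl re// mulr0.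
Qed.

(** Orthonormal vectors are independent, and a generating family bounds the
    number of independent vectors. *)
Lemma orthonormal_bound : finite_dimensional V ->
  exists n, forall e k, orthonormal e k -> (k <= n)%N.
Proof.
move=> [n [b bgen]]; exists n => e k oe; rewrite leqNgt; apply/negP => nk.
have [c hc] := choice (fun i : 'I_k => bgen (e i)).
have [|g [[i gi]] hg] := @linear_dependence R[i] 'I_n k c.
  by rewrite card_ord.
have : \sum_(i < k) g i *: e i = 0.
  under eq_bigr => j _ do rewrite hc scaler_sumr.
  rewrite exchange_big/= big1// => j _.
  under eq_bigr => l _ do rewrite scalerA.
  by rewrite -scaler_suml hg scale0r.
move/(congr1 (fun x => inner x (e i))); rewrite inner0l inner_suml.
rewrite (bigD1 i)//= innerZl oe// eqxx mulr1 big1 ?addr0.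
  by move=> g0; rewrite g0 eqxx in gi.
by move=> j /negbTE ji; rewrite innerZl oe// val_eqE ji mulr0.
Qed.

(** The vectors T^i m are dependent, so p(T) m = 0 for some nonzero polynomial
    p; factoring p over the algebraically closed field R[i], the last partial
    product that does not kill m yields an eigenvector. The predicate P stands
    for a T-stable subspace, and is used for orthogonal complements. *)
Lemma eigenvector_exists (T : {linear V -> V}) (P : V -> Prop) (m : V) :
  finite_dimensional V -> m != 0 -> P m ->
  (forall x y a, P x -> P y -> P (x - a *: y)) ->
  (forall x, P x -> P (T x)) ->
  exists v, [/\ v != 0, P v & exists a, T v = a *: v].
Proof.
move=> [n [b bgen]] m0 Pm PB PT.
pose app := foldr (fun z v => T v - z *: v) m.
have Papp r : P (app r) by elim: r => //= z r ih; apply: (PB) => //; exact: PT.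
suff [r r0] : exists r, app r = 0.
  elim: r r0 => [/= m00|z r ih /= /eqP]; first by rewrite m00 eqxx in m0.
  rewrite subr_eq0 => /eqP Tr.
  have [/ih//|r0] := eqVneq (app r) 0.
  by exists (app r); split=> //; exists z.
pose act N (p : {poly R[i]}) := \sum_(i < N) p`_i *: iter i T m.
have actM N (z : R[i]) (q : {poly R[i]}) : (size q < N)%N ->
    act N (('X - z%:P) * q) = T (act N q) - z *: act N q.
  case: N => // N; rewrite ltnS => qN.
  rewrite /act mulrBl.
  under eq_bigr do rewrite coefB scalerBl.
  rewrite big_split/= sumrN; congr (_ - _).
    rewrite big_ord_recl coefXM/= scale0r add0r linear_sum/= big_ord_recr/=.
    rewrite [q`_N]nth_default// scale0r linear0 addr0.
    by apply: eq_bigr => i _; rewrite coefXM/= linearZ.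
  by rewrite scaler_sumr; apply: eq_bigr => i _; rewrite coefCM scalerA.
have actE N (r : seq R[i]) : (size r < N)%N ->
    act N (\prod_(z <- r) ('X - z%:P)) = app r.
  elim: r => [|z r ih] rN.
    rewrite big_nil /act; case: N rN => // N _.
    rewrite big_ord_recl coef1/= scale1r big1 ?addr0// => i _.
    by rewrite coef1/= scale0r.
  by rewrite big_cons actM ?size_prod_XsubC// ih// ltnW.
have [c hc] := choice (fun i : 'I_n.+1 => bgen (iter i T m)).
have [|g [[i gi]] hg] := @linear_dependence R[i] 'I_n n.+1 c.
  by rewrite card_ord.
pose p := \poly_(i < n.+1) g (inord i).
have p0 : p != 0.
  apply/eqP => /polyP/(_ i); rewrite coef_poly ltn_ord inord_val coef0 => g0.
  by rewrite g0 eqxx in gi.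
have actp : act n.+1 p = 0.
  rewrite /act; under eq_bigr => j _ do
    rewrite coef_poly ltn_ord inord_val hc scaler_sumr.
  rewrite exchange_big/= big1// => j _.
  under eq_bigr => l _ do rewrite scalerA.
  by rewrite -scaler_suml hg scale0r.
have [r pr] := closed_field_poly_normal p.
exists r; rewrite -(actE n.+1).
  have lp : lead_coef p != 0 by rewrite lead_coef_eq0.
  apply: (scalerI lp); rewrite scaler0 -actp [in RHS]pr /act scaler_sumr.
  by apply: eq_bigr => j _; rewrite coefZ scalerA.
have := size_poly n.+1 (fun i => g (inord i)); rewrite -/p pr.
by rewrite size_scale ?lead_coef_eq0// size_prod_XsubC.
Qed.

(** An orthonormal family of eigenvectors that does not span can be extended,
    the orthogonal complement being T-stable, and its length is bounded. *)
Lemma spectral_theorem (T : {linear V -> V}) : finite_dimensional V ->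
  (forall x y, inner (T x) y = inner x (T y)) ->
  exists k e, [/\ orthonormal e k, spanning e k &
    forall i, (i < k)%N -> exists a, T (e i) = a *: e i].
Proof.
move=> Vfin Tsa; have [n nmax] := orthonormal_bound Vfin.
suff H k : (exists k e, [/\ orthonormal e k, spanning e k &
      forall i, (i < k)%N -> exists a, T (e i) = a *: e i]) \/
    exists e, orthonormal e k /\
      forall i, (i < k)%N -> exists a, T (e i) = a *: e i.
  by case: (H n.+1) => // -[e [/nmax]]; rewrite ltnn.
elim: k => [|k [|[e [oe ee]]]]; [by right; exists (fun=> 0); split|by left|].
have [ce|nce] := pselect (spanning e k); first by left; exists k, e.
right; have [m m0 me] := orthogonal_vector_exists oe nce.
have [||v [v0 ve [a Tv]]] := @eigenvector_exists T
  (fun x => forall i, (i < k)%N -> inner x (e i) = 0) m Vfin m0 me.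
- move=> x y a hx hy i ik.
  by rewrite innerDl innerNl innerZl hx// hy// mulr0 subr0.
- move=> x hx i ik; have [b Te] := ee i ik.
  by rewrite Tsa Te innerZr hx// mulr0.
have [b b0 vb] := unit_multiple_exists v0.
exists (rcons_fun e k (b *: v)); split.
  by apply: orthonormal_rcons => // i ik; rewrite innerZl ve// mulr0.
move=> i; rewrite ltnS /rcons_fun => ik; case: (eqVneq i k) => [_|ik'].
  by exists a; rewrite linearZ/= Tv !scalerA mulrC.
by apply: ee; rewrite ltn_neqAle ik'.
Qed.

End FiniteDimension.

(** * Rank one operators and singular values *)

Section RankOne.
Context {R : realType} {V W : hilbertType R}.

(** The complex form of Cauchy-Schwarz, deduced from the real one by rotating x
    so that its inner product with y becomes r = |<x, y>|^2. *)
Lemma inner_scale_bound (x y : V) : exists r : R,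
  [/\ 0 <= r, r <= sq x * sq y, `|inner x y| ^+ 2 = r%:C &
      forall w : W, sq (inner x y *: w) = r * sq w].
Proof.
set z := inner x y.
pose r := complex.Re z ^+ 2 + complex.Im z ^+ 2.
have zz : z^* * z = r%:C.
  rewrite /r; case: (z) => u v; apply/eqP; rewrite eq_complex /=.
  by apply/andP; split; apply/eqP; ring.
have sqz (U : hilbertType R) (w : U) : sq (z *: w) = r * sq w.
  by apply: complexI; rewrite -inner_sq innerZl innerZr mulrA
     [z * _]mulrC zz rmorphM/= inner_sq.
have sqz' (U : hilbertType R) (w : U) : sq (z^* *: w) = r * sq w.
  by apply: complexI; rewrite -inner_sq innerZl innerZr mulrA conjCK
     zz rmorphM/= inner_sq.
have r0 : 0 <= r by rewrite addr_ge0 ?sqr_ge0.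
exists r; split=> //; last by rewrite normCK mulrC.
have := cauchy_schwarz (z^* *: x) y; rewrite sqz'.
rewrite (_ : rin (z^* *: x) y = r); last by rewrite /rin innerZl -/z zz.
have [->|r1] := eqVneq r 0; first by rewrite mulr_ge0 ?sq_ge0.
by rewrite expr2 -mulrA ler_pM2l// lt_def r1.
Qed.

Lemma norm_inner_le (x y : V) : `|inner x y| <= `|x| * `|y|.
Proof.
have [r [r0 rle xyr _]] := inner_scale_bound x y.
rewrite -(@ler_pXn2r _ 2) ?nnegrE ?mulr_ge0//.
by rewrite exprMn -!inner_normE !inner_sq xyr -rmorphM/= lecR.
Qed.

Lemma rank_one_exists (w : W) (v : V) :
  exists f : bounded_op V W, forall h, f h = inner h v *: w.
Proof.
apply: (@bounded_op_of_sq _ _ _ _ (Num.sqrt (sq v * sq w))).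
- exact: sqrtr_ge0.
- by move=> a x y; rewrite innerDl innerZl scalerDl scalerA.
move=> h; rewrite sqr_sqrtr ?mulr_ge0 ?sq_ge0//.
have [r [r0 rle _ ->]] := inner_scale_bound h v.
rewrite [leRHS](_ : _ = sq h * sq v * sq w); last by ring.
by rewrite ler_wpM2r ?sq_ge0.
Qed.

Definition rank_one (w : W) (v : V) : bounded_op V W :=
  projT1 (cid (rank_one_exists w v)).

Lemma rank_oneE w v h : rank_one w v h = inner h v *: w.
Proof. exact: (projT2 (cid (rank_one_exists w v))). Qed.

Lemma rank_one_adj w v y : (rank_one w v)^† y = inner y w *: v.
Proof.
apply: inner_ext => h; rewrite -adjointP rank_oneE innerZl innerZr mulrC.
by rewrite -innerC.
Qed.

End RankOne.

Section SingularValues.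
Context {R : realType} {V W : hilbertType R}.
Implicit Types a b c : bounded_op V W.
Local Notation t := (@cartan_triple R V W).

Definition orth_tripotents (u : nat -> bounded_op V W) (k : nat) :=
  (forall i, (i < k)%N -> tripotent (u i)) /\
  (forall i j, (i < k)%N -> (j < k)%N -> i != j -> orth (u i) (u j)).

(** With e an orthonormal basis of eigenvectors of a a^†, the vectors a^† e_i
    are orthogonal and a is the sum of the rank one operators
    h |-> <h, a^† e_i> e_i. *)
Lemma singular_value_decomposition a : finite_dimensional W ->
  exists k (u : nat -> bounded_op V W) (s : nat -> R),
    orth_tripotents u k /\ a = \sum_(i < k) (s i)%:C *: u i.
Proof.
move=> Wfin.
have [x y|k [e [oe ce ee]]] := @spectral_theorem R W (op_comp a a^†) Wfin.
  by rewrite /= adjointP -adjointPr.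
have ve i j : (i < k)%N -> (j < k)%N -> i != j ->
    inner (a^† (e i)) (a^† (e j)) = 0.
  move=> ik jk ij; rewrite -adjointP; have [z /= ->] := ee i ik.
  by rewrite innerZl oe// (negbTE ij) mulr0.
pose s i := Num.sqrt (sq (a^† (e i))).
(* for s i = 0 the vector a^† e_i is 0, and u i = 0 is a tripotent too *)
pose u i := (s i)^-1%:C *: rank_one (e i) (a^† (e i)).
have uE i h : u i h = ((s i)^-1%:C * inner h (a^† (e i))) *: e i.
  by rewrite opZ rank_oneE scalerA.
have uV i y : (u i)^† y = ((s i)^-1%:C * inner y (e i)) *: a^† (e i).
  by rewrite adjointZ conj_real opZ rank_one_adj scalerA.
have ss i : (s i ^+ 2)%:C = inner (a^† (e i)) (a^† (e i)).
  by rewrite sqr_sqrtr ?sq_ge0// inner_sq.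
have s0 i : s i = 0 -> a^† (e i) = 0.
  move=> si; apply/eqP; rewrite -sq_eq0 -(inj_eq (@complexI R)) -inner_sq.
  by rewrite -ss si expr0n.
exists k, u, s; split; last first.
  apply: op_ext => h; rewrite op_sum [LHS]ce; apply: eq_bigr => i _.
  rewrite opZ uE scalerA adjointP mulrA -rmorphM/=; congr (_ *: _).
  have [si|si] := eqVneq (s i) 0; first by rewrite s0// inner0r mulr0.
  by rewrite mulfV// mul1r.
split=> [i ik h|i j ik jk ij].
  rewrite !uE uV !innerZl oe// eqxx mulr1 -ss; congr (_ *: _).
  have [si|si] := eqVneq (s i) 0; first by rewrite s0// inner0r !(mulr0,mul0r).
  have E : (s i)^-1%:C * (s i)^-1%:C * (s i ^+ 2)%:C = 1 :> R[i].
    by rewrite -!rmorphM/= -expr2 -exprMn mulVf ?expr1n.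
  by rewrite -[RHS]mulr1 -[X in _ = _ * X]E; ring.
split=> y.
  by rewrite uE uV innerZl ve// 1?eq_sym// !mulr0 scale0r.
rewrite adjointK uV uE innerZl oe// eq_sym (negbTE ij) !mulr0 scale0r//.
Qed.

Lemma cube_orth_sum (u : nat -> bounded_op V W) k (s : nat -> R) :
  orth_tripotents u k ->
  cube (\sum_(i < k) (s i)%:C *: u i) = \sum_(i < k) (s i ^+ 3)%:C *: u i.
Proof.
move=> [ut uo]; apply: op_ext => h; rewrite cubeE.
set a := \sum_(i < k) _.
have aE x : a x = \sum_(i < k) (s i)%:C *: u i x.
  by rewrite op_sum; apply: eq_bigr => i _; rewrite opZ.
have aV y : a^† y = \sum_(i < k) (s i)%:C *: (u i)^† y.
  apply: inner_ext => x; rewrite -adjointP aE inner_suml inner_sumr.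
  apply: eq_bigr => i _.
  by rewrite innerZl innerZr adjointP; congr (_ * _); rewrite conj_real.
have aVa : a^† (a h) = \sum_(i < k) (s i ^+ 2)%:C *: (u i)^† (u i h).
  rewrite aV; apply: eq_bigr => i _; rewrite aE linear_sum/= (bigD1 i)//=.
  rewrite big1 ?addr0; last first.
    move=> j ji; rewrite linearZ/=.
    rewrite eq_sym in ji.
    have [_ /(_ h)] := uo i j (ltn_ord _) (ltn_ord _) ji.
    by rewrite adjointK => ->; rewrite scaler0.
  by rewrite linearZ/= scalerA -rmorphM.
rewrite aVa aE op_sum; apply: eq_bigr => i _.
rewrite linear_sum/= (bigD1 i)//= big1 ?addr0; last first.
  move=> j ji; rewrite linearZ/=.
  rewrite eq_sym in ji.
  have [/(_ (u j h)) + _] := uo i j (ltn_ord _) (ltn_ord _) ji.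
  by move=> ->; rewrite scaler0.
by rewrite [RHS]opZ linearZ/= scalerA -rmorphM/= -exprS ut.
Qed.

(** Matrix coefficients turn identities between triple products into identities
    between complex numbers, which are settled by commutative algebra. *)
Section Word.
Variables (h : V) (y : W).
Definition word (p q r : bounded_op V W) : R[i] := inner (p (q^† (r h))) y.

Lemma wordDl p p' q r : word (p + p') q r = word p q r + word p' q r.
Proof. by rewrite /word opD innerDl. Qed.

Lemma wordDm p q q' r : word p (q + q') r = word p q r + word p q' r.
Proof. by rewrite /word adjointD opD linearD innerDl. Qed.

Lemma wordDr p q r r' : word p q (r + r') = word p q r + word p q r'.
Proof. by rewrite /word opD !linearD innerDl. Qed.

Lemma wordZl k p q r : word (k *: p) q r = k * word p q r.
Proof. by rewrite /word opZ innerZl. Qed.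

Lemma wordZm k p q r : word p (k *: q) r = k^* * word p q r.
Proof. by rewrite /word adjointZ opZ linearZ innerZl. Qed.

Lemma wordZr k p q r : word p q (k *: r) = k * word p q r.
Proof. by rewrite /word opZ !linearZ innerZl. Qed.

Definition wordE := (wordDl, wordDm, wordDr, wordZl, wordZm, wordZr).

Definition mel (f : bounded_op V W) : R[i] := inner (f h) y.

Lemma melD f g : mel (f + g) = mel f + mel g.
Proof. by rewrite /mel opD innerDl. Qed.

Lemma melN f : mel (- f) = - mel f.
Proof. by rewrite /mel opN innerNl. Qed.

Lemma melZ k f : mel (k *: f) = k * mel f.
Proof. by rewrite /mel opZ innerZl. Qed.

Lemma mel_triple a b c : mel (t a b c) = 2^-1 * (word a b c + word c b a).
Proof. by rewrite /mel tripleE innerZl innerDl. Qed.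

Definition melE := (melD, melN, melZ, mel_triple).

End Word.

Lemma op_inner_ext (f g : bounded_op V W) :
  (forall h y, mel h y f = mel h y g) -> f = g.
Proof.
move=> fg; apply: op_ext => h; apply: inner_ext => y.
by rewrite innerC [RHS]innerC -!/(mel _ _ _) fg.
Qed.

Lemma polar_outer a b c :
  t (a + c) b (a + c) = t a b a + t c b c + 2 *: t a b c.
Proof.
by apply: op_inner_ext => h y; rewrite !melE !wordE; field.
Qed.

Lemma mel_cube_line h y a b (k : R[i]) : mel h y (cube (a + k *: b)) =
  word h y a a a + k * (word h y b a a + word h y a a b)
  + k^* * word h y a b a + k * k^* * (word h y b b a + word h y a b b)
  + k ^+ 2 * word h y b a b + k ^+ 2 * k^* * word h y b b b.
Proof.
by rewrite cube_triple mel_triple !wordE; field.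
Qed.

(** Averaging lambda cube(a + lambda b) over the fourth roots of unity lambda
    isolates the term that is linear in conj lambda. *)
Lemma polar_middle a b :
  4 *: t a b a = cube (a + 1 *: b) - cube (a + (-1) *: b)
    + ('i : R[i])%R *: (cube (a + ('i : R[i])%R *: b)
                        - cube (a + (- 'i : R[i])%R *: b)).
Proof.
have ii : ('i * 'i = -1 :> R[i])%R by rewrite -expr2 sqrCi.
apply: op_inner_ext => h y.
have := mel_triple h y a b a; have := mel_cube_line h y a b 1.
have := mel_cube_line h y a b (-1); have := mel_cube_line h y a b 'i%R.
have := mel_cube_line h y a b (- 'i)%R.
move: (cube _) (cube _) (cube _) (cube _) (t _ _ _) => q1 q2 q3 q4 q5.
rewrite !(melD, melN, melZ) rmorphN/= conjCi opprK rmorph1 rmorphN1.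
by move=> -> -> -> -> ->; field: ii.
Qed.

End SingularValues.

(** * Conjugations are triple automorphisms *)

Section TripleAutomorphism.
Context {R : realType} {V W : hilbertType R}.
Variable tau : conjugation (bounded_op V W).
Local Notation t := (@cartan_triple R V W).
Implicit Types a b c : bounded_op V W.

Lemma tau_cube a : finite_dimensional W -> tau (cube a) = cube (tau a).
Proof.
move=> /(singular_value_decomposition a)[k [u [s [[ut uo] ->]]]].
rewrite cube_orth_sum// !tau_sum.
under eq_bigr do rewrite tauZr; under [in RHS]eq_bigr do rewrite tauZr.
rewrite (cube_orth_sum (u := tau \o u))//=; split=> [i ik|i j ik jk ij] /=.
  by apply: tau_tripotent; exact: ut.
apply: tau_orth; [apply: tau_tripotent| | |]; try exact: ut.
exact: uo.
Qed.

(** Polarization in the middle variable is semilinear over the fourth roots of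
    unity, and tau conjugates these on both sides. *)
Lemma tau_triple a b c : finite_dimensional W ->
  tau (t a b c) = t (tau a) (tau b) (tau c).
Proof.
move=> Wfin.
have n4 : 4 != 0 :> R[i] by rewrite pnatr_eq0.
have n2 : 2 != 0 :> R[i] by rewrite pnatr_eq0.
have mid x y : tau (t x y x) = t (tau x) (tau y) (tau x).
  apply: (scalerI n4); rewrite polar_middle.
  rewrite -[4 in LHS](rmorph_nat Num.conj) -tauZ polar_middle.
  rewrite tauD tauZ !tauD !tauN !tau_cube// !tauD !tauZ.
  rewrite rmorph1 rmorphN1 rmorphN/= conjCi opprK !scaleNr.
  by congr (_ + _); rewrite -scalerN; congr (_ *: _); exact: opprB.
apply: (scalerI n2); rewrite -[2 in LHS](rmorph_nat Num.conj) -tauZ.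
apply: (addrI (t (tau a) (tau b) (tau a) + t (tau c) (tau b) (tau c))).
by rewrite -[RHS]polar_outer -!mid -!tauD -[in LHS]polar_outer mid.
Qed.

End TripleAutomorphism.

(** * Right orthogonal sequences of operators with dense range *)

Section Orthogonality.
Context {R : realType} {H K : hilbertType R}.
Hypothesis K_fin : finite_dimensional K.
Local Notation E := (bounded_op H K).
Local Notation t := (@cartan_triple R H K).
Implicit Types u w z : E.

Lemma orthonormal_basis_exists :
  exists k (e : nat -> K), orthonormal e k /\ spanning e k.
Proof.
have [x y|k [e [oe ce _]]] :=
  @spectral_theorem R K (\0%R : {linear K -> K}) K_fin.
  by rewrite inner0l inner0r.
by exists k, e.
Qed.

Lemma op_eq0_on_basis (e : nat -> K) k (w : bounded_op K H) :
  spanning e k -> (forall i, (i < k)%N -> w (e i) = 0) -> forall y, w y = 0.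
Proof.
move=> ce we y; rewrite (ce y) linear_sum/= big1// => i _.
by rewrite linearZ/= we ?scaler0.
Qed.

(** If u u^† w = - w u^† u, then for an eigenvector e of u u^† with eigenvalue
    l >= 0, l |w^† e|^2 = <u u^† w w^† e, e> = - |u w^† e|^2. Both sides vanish,
    so u w^† = 0, and then u u^† w = 0 as well. *)
Lemma triple_uuw_orth u w : t u u w = 0 -> orth w u.
Proof.
move=> uuw.
have uuwh h : u (u^† (w h)) = - w (u^† (u h)).
  apply/eqP; rewrite -addr_eq0.
  have /(congr1 (fun f : E => f h)) := uuw.
  rewrite tripleE => /eqP; rewrite scaler_eq0 invr_eq0 pnatr_eq0/=.
  by [].
have [x y|k [e [oe ce ee]]] := @spectral_theorem R K (op_comp u u^†) K_fin.
  by rewrite /= adjointP -adjointPr.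
have uw : rorth u w.
  move=> y; rewrite (ce y) !linear_sum/= big1// => i _.
  rewrite !linearZ/=; suff -> : u (w^† (e i)) = 0 by rewrite scaler0.
  have [a /= uue] := ee i (ltn_ord _).
  have aE : a = (sq (u^† (e i)))%:C.
    have := congr1 (fun x => inner x (e i)) uue.
    by rewrite adjointP innerZl oe// eqxx mulr1 inner_sq => <-.
  have : rin (w (u^† (u (w^† (e i))))) (e i) = sq (u (w^† (e i))).
    by rewrite rin_adj rinC -rin_adj.
  rewrite -[w _]opprK -uuwh rinNl rin_adj rin_adj adjointK uue rinC.
  rewrite [X in _ = X -> _]/sq => E'.
  apply/sq0P; apply/eqP; rewrite eq_le sq_ge0 andbT.
  rewrite /sq -E' aE rinZl rin_adjr -/(sq _).
  by rewrite oppr_le0 mulr_ge0 ?sq_ge0.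
have wu : rorth w u by exact: rorth_sym.
split=> //; apply: rorth_sym => h; rewrite adjointK; apply: sq0P.
by rewrite /sq -rin_adjr uuwh wu oppr0 rin0r.
Qed.

Lemma orth_triple_uuw u w : orth w u -> t u u w = 0.
Proof.
move=> [wu /rorth_sym uw]; apply: op_ext => h; rewrite tripleE wu.
by have := uw h; rewrite adjointK => ->; rewrite linear0 addr0 scaler0.
Qed.

(** Stated on the adjoint, which is how it is used; in finite-dimensional K it
    means that z is onto. *)
Definition dense_range z := forall y, z^† y = 0 -> y = 0.

Lemma rorth_of_triple_eq0 z w : dense_range z -> t z w z = 0 -> rorth w z.
Proof.
move=> fz zwz y; apply: fz; apply: inner_ext => h.
by rewrite -adjointP adjointPr -adjointP -triple_diagE zwz inner0l inner0r.
Qed.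

(** Finitely many operators into K impose finitely many linear conditions. *)
Lemma common_kernel (L : seq E) : ~ finite_dimensional H ->
  exists2 h, h != 0 & forall a, a \in L -> a h = 0.
Proof.
move=> H_inf; have [k [e [oe ce]]] := orthonormal_basis_exists.
pose I : finType := ('I_(size L) * 'I_k)%type.
have [f of_] := orthonormal_exists #|I|.+1 H_inf.
have [|g [[i gi]] hg] := @linear_dependence R[i] I #|I|.+1
  (fun i p => inner ((nth 0 L p.1) (f i)) (e p.2)); first by [].
exists (\sum_(i < #|I|.+1) g i *: f i).
  apply: contra gi => /eqP/(congr1 (fun x => inner x (f i))).
  rewrite inner0l inner_suml (bigD1 i)//= innerZl of_// eqxx mulr1.
  rewrite big1 ?addr0 => [->//|j /negbTE ji].
  by rewrite innerZl of_// val_eqE ji mulr0.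
move=> a /(nthP 0)[l lL <-]; rewrite [LHS]ce big1// => j _.
rewrite linear_sum inner_suml [X in X *: _](_ : _ = 0) ?scale0r//.
by have := hg (Ordinal lL, j) => /= {2}<-; apply: eq_bigr => q _;
   rewrite linearZ innerZl.
Qed.

(** P is thought of as a real subspace that contains a nonzero solution of every
    system of triple conditions {z, w, z} = 0 (right orthogonality, for z of
    dense range) and {u, u, w} = 0 (orthogonality), with z, u in P, that has a
    nonzero solution in E. *)
Definition rich (P : E -> Prop) :=
  [/\ P 0, (forall a b, P a -> P b -> P (a + b)) &
  (forall Z U : seq E,
     (forall z, z \in Z -> P z) -> (forall u, u \in U -> P u) ->
     (exists w, [/\ w != 0, (forall z, z \in Z -> t z w z = 0) &
       forall u, u \in U -> t u u w = 0]) ->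
     exists w, [/\ P w, w != 0, (forall z, z \in Z -> t z w z = 0) &
       forall u, u \in U -> t u u w = 0])].

Lemma rich_setT : rich (fun=> True).
Proof. by split=> // Z U _ _ [w [w0 zw uw]]; exists w. Qed.

Lemma op_neq0 w : w != 0 -> exists h, w h != 0.
Proof.
move=> w0; apply: contrapT => /forallNP wh; move/eqP: w0; apply.
by apply: op_ext => h; apply/eqP/negPn/negP; exact: wh.
Qed.

Hypothesis H_inf : ~ finite_dimensional H.

(** Otherwise orthogonal families u_1, ..., u_m of nonzero solutions could be
    prolonged for ever: their sum s misses a vector y of K, and the rank one
    operator from a common zero of the u_i and of Z to y is a new solution
    orthogonal to all u_i. But the ranges of the u_i are mutually orthogonal
    in K. *)
Lemma dense_range_exists (P : E -> Prop) (Z : seq E) : rich P ->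
  (forall z, z \in Z -> P z) ->
  exists w, [/\ P w, dense_range w & forall z, z \in Z -> t z w z = 0].
Proof.
move=> [P0 PD Prich] PZ; apply: contrapT => nofull.
have [n nmax] := orthonormal_bound K_fin.
have [d [e [oe ce]]] := orthonormal_basis_exists.
suff fam m : exists u : nat -> E, (forall i, (i < m)%N ->
      [/\ P (u i), u i != 0 & forall z, z \in Z -> t z (u i) z = 0]) /\
    forall i j, (i < m)%N -> (j < m)%N -> i != j -> orth (u i) (u j).
  have [u [hu ou]] := fam n.+1.
  have hr i : exists v, (i < n.+1)%N ->
      inner v v = 1 /\ exists h, v = u i h.
    have [ni|ni] := leqP i n; last by exists 0 => /(leq_trans ni); rewrite ltnn.
    have [_ /op_neq0[h uh] _] := hu i ni.
    have [a _ a1] := unit_multiple_exists uh.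
    by exists (a *: u i h) => _; split=> //; exists (a *: h); rewrite linearZ.
  have [f hf] := choice hr.
  suff /nmax : orthonormal f n.+1 by rewrite ltnn.
  move=> i j im jm; have [fi1 [h fi]] := hf i im; have [_ [h' fj]] := hf j jm.
  have [<-|ij] := eqVneq i j; first by [].
  rewrite fi fj adjointPr; rewrite eq_sym in ij.
  have [_ /(_ h)] := ou _ _ jm im ij.
  by rewrite adjointK => ->; rewrite inner0l.
elim: m => [|m [u [hu ou]]]; first by exists (fun=> 0); split.
pose s := \sum_(i < m) u i.
have Ps : P s by apply: big_ind => // i _; have [] := hu i (ltn_ord i).
have sE y : s^† y = \sum_(i < m) (u i)^† y.
  apply: inner_ext => x; rewrite -adjointP op_sum inner_suml inner_sumr.
  by apply: eq_bigr => i _; rewrite adjointP.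
have Zs z : z \in Z -> t z s z = 0.
  move=> zZ; apply: op_ext => h.
  rewrite triple_diagE sE linear_sum big1// => i _.
  by have [_ _ /(_ z zZ) uz] := hu i (ltn_ord i); rewrite /= -triple_diagE uz.
have [y y0 sy] : exists2 y, y != 0 & s^† y = 0.
  apply: contrapT => noy; apply: nofull; exists s; split=> // y sy.
  by apply: contrapT => /eqP y0; apply: noy; exists y.
have uy i : (i < m)%N -> (u i)^† y = 0.
  move=> im; apply: sq0P; rewrite /sq -rin_adjr.
  suff -> : u i ((u i)^† y) = 0 by rewrite rin0r.
  have := congr1 (u i) sy.
  rewrite linear0 sE linear_sum (bigD1 (Ordinal im))//=.
  rewrite big1 ?addr0// => j ji.
  by have [|/(_ y)] := ou i j im (ltn_ord j); first by rewrite eq_sym.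
pose U : seq E := mkseq u m.
have UL (a : E) : a \in U -> exists2 i, (i < m)%N & a = u i.
  move=> /(nthP 0)[l]; rewrite size_mkseq => lm.
  by rewrite nth_mkseq// => <-; exists l.
have uL i : (i < m)%N -> u i \in U.
  by move=> im; rewrite -(nth_mkseq 0 u im) mem_nth// size_mkseq.
have [h h0 hL] := common_kernel (Z ++ U) H_inf.
have uh i : (i < m)%N -> u i h = 0.
  by move=> im; apply: hL; rewrite mem_cat uL ?orbT.
have [w [Pw w0 zw uw]] : exists w, [/\ P w, w != 0,
    (forall z, z \in Z -> t z w z = 0) &
    forall a, a \in U -> t a a w = 0].
  apply: Prich => //.
    by move=> a /UL[i im ->]; have [] := hu i im.
  exists (rank_one y h); split=> [|z zZ|a /UL[i im ->]].
  - apply: contra y0 => /eqP/(congr1 (fun f : E => f h)).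
    rewrite rank_oneE => /eqP; rewrite scaler_eq0 inner_sq.
    by rewrite (inj_eq (@complexI R)) sq_eq0 (negbTE h0).
  - apply: op_ext => x; rewrite triple_diagE rank_one_adj linearZ.
    by rewrite /= hL ?scaler0// mem_cat zZ.
  - apply: orth_triple_uuw; split=> x.
      by rewrite rank_oneE -adjointPr uh// inner0r scale0r.
    by rewrite adjointK rank_one_adj adjointP uy// inner0r scale0r.
have wu i : (i < m)%N -> orth w (u i).
  by move=> im; apply/triple_uuw_orth/uw/uL.
exists (rcons_fun u m w); rewrite /rcons_fun; split.
  move=> i; rewrite ltnS leq_eqVlt => /orP[im|im]; first by rewrite im; split.
  by rewrite (ltn_eqF im); exact: hu.
move=> i j; rewrite !ltnS (leq_eqVlt i) (leq_eqVlt j).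
have [->|im] := eqVneq i m; have [jm|jm] := eqVneq j m => //=.
- by move=> _ jm' _; exact: wu.
- by move=> im' _ _; apply: orth_sym; exact: wu.
- exact: ou.
Qed.

(** Each term is taken right orthogonal to the list of the preceding ones. *)
Lemma dense_range_sequence (P : E -> Prop) : rich P ->
  exists z : nat -> E, [/\ forall i, P (z i), forall i, dense_range (z i) &
    forall i j, i != j -> rorth (z i) (z j)].
Proof.
move=> Prich.
have ex (Z : seq E) : exists w, (forall z, z \in Z -> P z) ->
    [/\ P w, dense_range w & forall z, z \in Z -> t z w z = 0].
  have [PZ|nPZ] := pselect (forall z, z \in Z -> P z).
    by have [w hw] := dense_range_exists Prich PZ; exists w.
  by exists 0.
have [f hf] := choice ex.
pose Z n := iter n (fun Z => f Z :: Z) [::].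
have PZ n : forall z, z \in Z n -> P z.
  elim: n => // n ih z; rewrite inE => /orP[/eqP->|/ih//].
  by have [] := hf (Z n) ih.
have mZ i j : (i < j)%N -> f (Z i) \in Z j.
  elim: j => // j ih; rewrite ltnS leq_eqVlt => /orP[/eqP->|/ih ij].
    exact: mem_head.
  by rewrite inE ij orbT.
exists (fun n => f (Z n)); split=> [i|i|i j].
- by have [] := hf (Z i) (PZ i).
- by have [] := hf (Z i) (PZ i).
have key p q : (p < q)%N -> rorth (f (Z q)) (f (Z p)).
  move=> pq; have [_ _ h] := hf (Z q) (PZ q).
  have [_ fp _] := hf (Z p) (PZ p).
  by apply: rorth_of_triple_eq0 => //; apply/h/mZ.
by rewrite neq_ltn => /orP[/key|/key//]; exact: rorth_sym.
Qed.

End Orthogonality.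

Section FixedPointsRich.
Context {R : realType} {H K : hilbertType R}.
Hypothesis K_fin : finite_dimensional K.
Variable tau : conjugation (bounded_op H K).
Local Notation E := (bounded_op H K).
Local Notation t := (@cartan_triple R H K).

(** The solution sets are complex subspaces stable by tau, so they contain
    w + tau w, and i w when tau w = - w. *)
Lemma rich_fixed : rich (fun a : E => tau a = a).
Proof.
split=> [|a b ta tb|Z U Zt Ut [w [w0 zw uw]]]; first exact: tau0.
  by rewrite tauD ta tb.
have [tz tu] : (forall z, z \in Z -> t z (tau w) z = 0) /\
    (forall u, u \in U -> t u u (tau w) = 0).
  split=> [z zZ|u uU].
    by rewrite -[z in LHS](Zt z zZ) -tau_triple// zw// tau0.
  by rewrite -[u in LHS](Ut u uU) -tau_triple// uw// tau0.
(* t z w z is conjugate linear and t u u w linear in w *)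
have comb (k l : R[i]) :
    (forall z, z \in Z -> t z (k *: w + l *: tau w) z = 0) /\
    (forall u, u \in U -> t u u (k *: w + l *: tau w) = 0).
  split=> [z zZ|u uU]; apply: op_inner_ext => h y.
    have := mel_triple h y z w z; have := mel_triple h y z (tau w) z.
    rewrite zw// tz// mel_triple !wordE /mel !inner0l => e1 e2.
    rewrite [LHS](_ : _ = k^* * (2^-1 * (word h y z w z + word h y z w z)) +
      l^* * (2^-1 * (word h y z (tau w) z + word h y z (tau w) z))); last ring.
    by rewrite -e1 -e2 !mulr0 addr0.
  have := mel_triple h y u u w; have := mel_triple h y u u (tau w).
  rewrite uw// tu// mel_triple !wordE /mel !inner0l => e1 e2.
  rewrite [LHS](_ : _ = k * (2^-1 * (word h y u u w + word h y w u u)) +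
    l * (2^-1 * (word h y u u (tau w) + word h y (tau w) u u))); last ring.
  by rewrite -e1 -e2 !mulr0 addr0.
have [ww|ww] := eqVneq (w + tau w) 0.
  have tw : tau w = - w by apply/eqP; rewrite -addr_eq0 addrC ww.
  exists (('i : R[i])%R *: w + 0 *: tau w); split.
  - rewrite tauD !tauZ rmorph0 !scale0r !addr0 conjCi tw.
    by rewrite scalerN scaleNr opprK.
  - by rewrite scale0r addr0 scaler_eq0 negb_or w0 neq0Ci.
  - by have [] := comb 'i%R 0.
  - by have [] := comb 'i%R 0.
exists (1 *: w + 1 *: tau w); split.
- by rewrite !scale1r tauD conjugation_involutive addrC.
- by rewrite !scale1r.
- by have [] := comb 1 1.
- by have [] := comb 1 1.
Qed.

End FixedPointsRich.

(** * Weighted series of operators *)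

Section OperatorSeries.
Context {R : realType} {V : hilbertType R}.
Local Open Scope classical_set_scope.
Implicit Types (h x y : V).

(** The weights c_k make the terms c_k Y_k geometrically small. The sum is built
    weakly: for each h the scalar series is a real-linear functional of y to
    which Riesz applies, the factor 1/4 leaving room for the bound it asks. *)
Lemma operator_series (Y : nat -> bounded_op V V) :
  exists (c : nat -> R) (T : bounded_op V V), (forall k, 0 < c k) /\
    forall h y, cvgn (series (fun k => c k * rin (Y k h) y)) /\
      rin (T h) y = limn (series (fun k => c k * rin (Y k h) y)).
Proof.
have /choice[m hm] k : exists m : R, forall h, sq (Y k h) <= m ^+ 2 * sq h.
  by have [m _ hm] := bounded_sq (Y k); exists m.
pose c k : R := 4^-1 * 2^-1 ^+ k / (1 + m k ^+ 2).
have m1 k : 0 < 1 + m k ^+ 2 by rewrite ltr_wpDr ?sqr_ge0.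
have c0 k : 0 < c k by rewrite divr_gt0// mulr_gt0// exprn_gt0.
pose f h y k := c k * rin (Y k h) y.
have fle h y k : `|f h y k| <= geometric (8^-1 * (sq h + sq y)) 2^-1 k.
  have h1 : `|rin (Y k h) y| <= 2^-1 * (1 + m k ^+ 2) * (sq h + sq y).
    have := sq_ge0 (Y k h - y); have := sq_ge0 (Y k h + y); rewrite sqD sqB.
    have := hm k h; have := mulr_ge0 (sqr_ge0 (m k)) (sq_ge0 y).
    have := sq_ge0 h; rewrite ler_norml.
    move: (sq (Y k h)) (rin _ _) (sq h) (sq y) (m k ^+ 2).
    move=> a b p q r ? ? ? ? ?.
    by apply/andP; split; lra.
  rewrite /f normrM gtr0_norm//; apply: (le_trans (ler_wpM2l (ltW (c0 k)) h1)).
  rewrite /= le_eqVlt; apply/orP; left; apply/eqP; rewrite /c; field.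
  by rewrite lt0r_neq0.
have half : `|2^-1 : R| < 1 by rewrite gtr0_norm// invf_lt1// ltr1n.
have nf h y : cvgn [normed series (f h y)].
  apply: series_le_cvg (fle h y) _ => [k|k|] //.
    by apply: (le_trans (normr_ge0 _) (fle h y k)).
  exact: is_cvg_geometric_series.
have cf h y : cvgn (series (f h y)) by exact: normed_cvg.
have gle h y : `|limn (series (f h y))| <= 4^-1 * (sq h + sq y).
  apply: (le_trans (lim_series_norm (nf h y))).
  have -> : 4^-1 * (sq h + sq y) =
      limn (series (geometric (8^-1 * (sq h + sq y)) (2^-1 : R))).
    rewrite (cvg_lim _ (cvg_geometric_series _))//; by field.
  apply: lim_series_le (fle h y) => //; first exact: nf.
  exact: is_cvg_geometric_series.
have fDr h x y : f h (x + y) = f h x + f h y.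
  by apply/funext => k; rewrite /f rinDr mulrDr.
have fZr h (a : R) y : f h (a%:C *: y) = a *: f h y.
  by apply/funext => k; rewrite /f rinZr mulrCA.
have ex h : exists x, forall y, limn (series (f h y)) = rin y x.
  apply: (@riesz_rin R V (fun y => limn (series (f h y))) (sq h)).
  - by move=> x y; rewrite fDr lim_seriesD.
  - by move=> a y; rewrite fZr lim_seriesZ.
  - move=> y; have := gle h y; have := sq_ge0 h; have := sq_ge0 y.
    rewrite ler_norml => ? ? /andP[_ ?]; lra.
have /choice[T hT] := ex.
have lT : linear T.
  move=> a x y; apply: rin_ext => z.
  rewrite rinDr -hT -(rinC (a *: _)) rinZC rinC.
  rewrite -!hT -lim_seriesD//; congr (limn (series _)); apply/funext => k.
  by rewrite /f linearD linearZ rinDl rinZC mulrDr.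
have bT h : sq (T h) <= 1 ^+ 2 * sq h.
  have := gle h (T h); rewrite hT -/(sq _) ger0_norm ?sq_ge0//.
  have := sq_ge0 h; rewrite expr1n mul1r; lra.
have [T' hT'] := bounded_op_of_sq ler01 lT bT.
exists c, T'; split; first exact: c0.
by move=> h y; split; [exact: cf|rewrite hT' rinC -hT].
Qed.

End OperatorSeries.

Section OperatorSeriesCorollaries.
Context {R : realType} {V : hilbertType R}.

Definition skew (T : bounded_op V V) := T^† = - T.

(** When only the term of index l contributes, the series is that term. *)
Lemma skew_operator_series (Y : nat -> bounded_op V V) :
  (forall k, skew (Y k)) ->
  exists (c : nat -> R) (T : bounded_op V V), [/\ forall k, 0 < c k, skew T &
    forall h y l, (forall k, k != l -> rin (Y k h) y = 0) ->
      rin (T h) y = c l * rin (Y l h) y].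
Proof.
move=> Ysk; have [c [T [c0 hT]]] := operator_series Y.
exists c, T; split=> // [|h y l hl].
  apply: op_ext => y; apply: rin_ext => h; rewrite -rin_adj opN rinNr.
  have [ch ->] := hT h y; have [cy e] := hT y h; rewrite [in RHS]rinC e.
  rewrite -lim_seriesN//; congr (limn (series _)); apply/funext => k.
  by rewrite rin_adj Ysk opN rinNr mulrN rinC.
have [_ ->] := hT h y; apply: (@lim_near_cst R^o) => //.
exists l.+1 => // n /= ln; rewrite /series /= big_mkord.
rewrite (bigD1 (Ordinal ln))//= big1 ?addr0// => k kl.
by rewrite hl ?mulr0.
Qed.

End OperatorSeriesCorollaries.

(** * The trace form and its ternary derivation *)

Section Trace.
Context {R : realType} {K : hilbertType R}.
Variables (d : nat) (e : nat -> K).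
Hypotheses (oe : orthonormal e d) (ce : spanning e d).

(** On bare functions, so that composites can be written pointwise. *)
Definition trace (P : K -> K) : R[i] := \sum_(i < d) inner (P (e i)) (e i).

(** Both sides are the double sum of <Q e_i, e_j> <P e_j, e_i>. *)
Lemma traceC (P Q : {linear K -> K}) :
  trace (fun y => P (Q y)) = trace (fun y => Q (P y)).
Proof.
have E (A B : {linear K -> K}) : trace (fun y => A (B y)) =
    \sum_(i < d) \sum_(j < d) inner (B (e i)) (e j) * inner (A (e j)) (e i).
  apply: eq_bigr => i _; rewrite [in LHS](ce (B (e i))) linear_sum inner_suml.
  by apply: eq_bigr => j _; rewrite linearZ innerZl.
rewrite !E exchange_big/=; apply: eq_bigr => i _; apply: eq_bigr => j _.
exact: mulrC.
Qed.

End Trace.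

Section TraceForm.
Context {R : realType} {H K : hilbertType R}.
Local Notation E := (bounded_op H K).
Local Notation t := (@cartan_triple R H K).
Variables (d : nat) (e : nat -> K).
Hypotheses (oe : orthonormal e d) (ce : spanning e d).
Variable T : bounded_op H H.
Hypothesis Tskew : skew T.

(** tr (x T a^†), that is, the pairing of x with the element - a T of the dual. *)
Definition trace_form (a x : E) : R[i] := trace d e (fun y => x (T (a^† y))).

(** tr (p T q^† r s^†); every trace below is brought to this form by cyclic
    permutation. *)
Definition trace_word (p q r s : E) : R[i] :=
  trace d e (fun y => p (T (q^† (r (s^† y))))).

Lemma trace_form_triple_l a b c x :
  trace_form (t a b c) x = 2^-1 * (trace_word x a b c + trace_word x c b a).
Proof.
rewrite -big_split mulr_sumr; apply: eq_bigr => i _.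
rewrite adjoint_triple !linearZ innerZl; congr (_ * _).
by rewrite !linearD innerDl.
Qed.

Lemma trace_form_triple_r a b c x :
  trace_form a (t b c x) = 2^-1 * (trace_word x a b c + trace_word b a x c).
Proof.
have -> : trace_form a (t b c x) = 2^-1 *
    (trace d e (fun y => op_comp b c^† (op_comp x (op_comp T a^†) y)) +
     trace d e (fun y => op_comp x c^† (op_comp b (op_comp T a^†) y))).
  rewrite -big_split mulr_sumr; apply: eq_bigr => i _.
  by rewrite tripleE innerZl innerDl.
by rewrite !(traceC ce (op_comp _ _^†)).
Qed.

Lemma trace_form_triple_m a b c x :
  (trace_form b (t a x c))^* =
  - (2^-1 * (trace_word b c x a + trace_word b a x c)).
Proof.
rewrite /trace_form /trace_word /trace rmorph_sum -big_split mulr_sumr -sumrN.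
apply: eq_bigr => i _; rewrite -[LHS]innerC tripleE innerZr innerDr.
rewrite fmorphV rmorph_nat -mulrN opprD; congr (_ * (_ + _)).
  by rewrite !adjointPr !adjointK Tskew opN linearN innerNl.
by rewrite !adjointPr !adjointK Tskew opN linearN innerNl.
Qed.

(** The words that do not appear on the left cancel because T is skew. *)
Lemma trace_form_derivation a b c x : trace_form (t a b c) x =
  trace_form a (t b c x) + (trace_form b (t a x c))^* + trace_form c (t b a x).
Proof.
by rewrite trace_form_triple_l trace_form_triple_m (trace_form_triple_r a b c)
   (trace_form_triple_r c b a); ring.
Qed.

Lemma trace_form_linear_r a k x y :
  trace_form a (k *: x + y) = k * trace_form a x + trace_form a y.
Proof.
rewrite /trace_form /trace mulr_sumr -big_split; apply: eq_bigr => i _.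
by rewrite opD opZ innerDl innerZl.
Qed.

Lemma trace_form_conj_l k a b x :
  trace_form (k *: a + b) x = k^* * trace_form a x + trace_form b x.
Proof.
rewrite /trace_form /trace mulr_sumr -big_split; apply: eq_bigr => i _.
by rewrite adjointD adjointZ opD opZ !linearD !linearZ innerDl innerZl.
Qed.

Lemma adjoint_norm (U U' : hilbertType R) (f : bounded_op U U') y :
  `|f^† y| <= `|f| * `|y|.
Proof.
have [m0 fE] : 0 <= complex.Re `|f| /\ `|f| = (complex.Re `|f|)%:C.
  have h : `|f| = (complex.Re `|f|)%:C by rewrite complex_rc_reK// normr_ge0.
  by split=> //; rewrite -lecR -h normr_ge0.
have /adjoint_le : forall x, sq (f x) <= complex.Re `|f| ^+ 2 * sq x.
  by apply/opnorm_sq; rewrite -?fE.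
move=> /(_ (exprn_ge0 2 m0) y) h; rewrite fE [`|y|]norm_sq -rmorphM/= norm_leM.
  by rewrite exprMn sqr_sqrtr ?sq_ge0.
by rewrite mulr_ge0 ?sqrtr_ge0.
Qed.

Lemma trace_form_bound a x : `|trace_form a x| <= (d%:R * `|T|) * `|a| * `|x|.
Proof.
rewrite /trace_form (le_trans (ler_norm_sum _ _ _))//.
rewrite -!mulrA mulr_natl -[X in _ *+ X]card_ord -sumr_const ler_sum// => i _.
have e1 : `|e i| = 1.
  by apply/eqP; rewrite -(@eqrXn2 _ 2)// -inner_normE oe// eqxx expr1n.
rewrite (le_trans (norm_inner_le _ _))// e1 mulr1.
rewrite (le_trans (le_opnorm x _))// [leRHS]mulrA mulrC ler_wpM2r ?opnorm_ge0//.
rewrite (le_trans (le_opnorm T _))// ler_wpM2l ?opnorm_ge0//.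
by rewrite (le_trans (adjoint_norm a _))// e1 mulr1.
Qed.

End TraceForm.

(** * A form that no inner derivation can produce *)

Section NonInner.
Context {R : realType} {H K : hilbertType R}.
Local Notation E := (bounded_op H K).
Local Notation t := (@cartan_triple R H K).
Hypothesis K_neq0 : exists y : K, y != 0.
Hypothesis K_fin : finite_dimensional K.
Hypothesis H_inf : ~ finite_dimensional H.

Lemma dense_range_injective (z : E) :
  dense_range z -> forall y, z (z^† y) = 0 -> y = 0.
Proof.
by move=> fz y zy; apply/fz/sq0P; rewrite /sq -rin_adjr zy rin0r.
Qed.

(** The infinitesimal rotation exchanging the initial spaces of p and q. *)
Definition rotation (p q : E) : bounded_op H H :=
  op_comp p^† q - op_comp q^† p.

Lemma rotationE p q h : rotation p q h = p^† (q h) - q^† (p h).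
Proof. by []. Qed.

Lemma skew_rotation p q : skew (rotation p q).
Proof.
apply: op_ext => y; apply: inner_ext => x.
rewrite -adjointP opN !rotationE innerDl innerNl innerNr innerDr innerNr.
by rewrite -!adjointPr -!adjointP opprD opprK addrC.
Qed.

Definition real_comb (N : nat) (g : 'I_N -> R) (z : nat -> E) : E :=
  \sum_(l < N) (g l)%:C *: z l.

Lemma real_combE N (g : 'I_N -> R) z h :
  real_comb g z h = \sum_(l < N) (g l)%:C *: z l h.
Proof. by rewrite op_sum. Qed.

Lemma real_comb_adj N (g : 'I_N -> R) z y :
  (real_comb g z)^† y = \sum_(l < N) (g l)%:C *: (z l)^† y.
Proof.
apply: inner_ext => x; rewrite -adjointP real_combE inner_suml inner_sumr.
by apply: eq_bigr => i _; rewrite innerZl innerZr adjointP conj_real.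
Qed.

Lemma rin_suml I (s : seq I) (V : hilbertType R) (F : I -> V) y :
  rin (\sum_(i <- s) F i) y = \sum_(i <- s) rin (F i) y.
Proof. by rewrite /rin inner_suml raddf_sum. Qed.

Lemma rin_sumr I (s : seq I) (V : hilbertType R) (F : I -> V) y :
  rin y (\sum_(i <- s) F i) = \sum_(i <- s) rin y (F i).
Proof. by rewrite rinC rin_suml; apply: eq_bigr => i _; rewrite rinC. Qed.

(** The conditions are finitely many real-linear equations in the coefficients
    g: the real and imaginary parts of the coordinates of the images of the
    vectors b^† e_i. Real coefficients keep the combinations in a real
    subspace. *)
Lemma real_comb_annihilate (a x : nat -> E) (L : seq E) :
  exists N (g : 'I_N -> R), (exists l, g l != 0) /\
    forall b, b \in L ->
      rorth (real_comb g a) b /\ rorth (real_comb g x) b.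
Proof.
have [d [e [oe ce]]] := orthonormal_basis_exists K_fin.
pose I : finType := ('I_(size L) * 'I_d * 'I_d * bool * bool)%type.
pose fe (im : bool) j := if im then ('i%C : R[i]) *: e j else e j.
pose f (l : 'I_#|I|.+1) (s : I) := let: (q, i, j, im, ax) := s in
  rin ((if ax then a l else x l) ((nth 0 L q)^† (e i))) (fe im j).
have [|g [g0 hg]] := @linear_dependence R I #|I|.+1 f; first by [].
exists #|I|.+1, g; split=> // b /(nthP 0)[q qL <-].
have key (ax : bool) : rorth (real_comb g (if ax then a else x)) (nth 0 L q).
  have Ke (w : bounded_op K K) : (forall i, (i < d)%N -> w (e i) = 0) ->
      forall y, w y = 0 by exact: op_eq0_on_basis.
  apply: (Ke (op_comp (real_comb g (if ax then a else x)) (nth 0 L q)^†)).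
  move=> i id /=; rewrite [LHS]ce big1// => j _.
  set v := real_comb _ _ _.
  suff -> : inner v (e j) = 0 by rewrite scale0r.
  (* fe false j and fe true j test real and imaginary parts *)
  have vE im : rin v (fe im j) = 0.
    have := hg (Ordinal qL, Ordinal id, j, im, ax); rewrite /f /= => <-.
    rewrite /v real_combE rin_suml; apply: eq_bigr => l _.
    by rewrite rinZl; case: (ax).
  have := vE false; have := vE true; rewrite /fe /rin innerZr.
  case: (inner v (e j)) => u w /= h1 h2; apply/eqP; rewrite eq_complex /=.
  by apply/andP; split; apply/eqP; lra.
by split; [exact: (key true)|exact: (key false)].
Qed.

(** tr (B^2 A^2) = tr (B A^2 B) is the sum of the |A B e_i|^2, where A = a a^†
    and B = x x^† are injective. This is why cubes of a_k and x_k enter in T: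
    without them one would meet tr (B A), whose positivity is less direct. *)
Lemma trace_squares_gt0 d (e : nat -> K) (a x : E) :
  orthonormal e d -> spanning e d -> dense_range a -> dense_range x ->
  0 < \sum_(i < d)
    rin (a (a^† (a (a^† (e i))))) (x (x^† (x (x^† (e i))))).
Proof.
have sa (z : E) u v : rin (z (z^† u)) v = rin u (z (z^† v)).
  by rewrite rin_adj -rin_adjr.
move=> oe ce fa fx; pose A := op_comp a a^†; pose B := op_comp x x^†.
have -> : \sum_(i < d)
      rin (a (a^† (a (a^† (e i))))) (x (x^† (x (x^† (e i))))) =
    complex.Re (trace d e (fun y => B (op_comp B (op_comp A A) y))).
  rewrite /trace raddf_sum; apply: eq_bigr => i _ /=; rewrite -/(rin _ _).
  by rewrite !sa.
rewrite (traceC ce) /trace raddf_sum /=.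
have E1 i : complex.Re
    (inner (x (x^† (a (a^† (a (a^† (x (x^† (e i))))))))) (e i)) =
    sq (a (a^† (x (x^† (e i))))).
  by rewrite -/(rin _ _) /sq !sa.
under eq_bigr do rewrite E1.
have [d0 d0P] : exists i : 'I_d, True.
  case: d oe ce {E1} => [|n] _ ce; last by exists ord0.
  by have [y] := K_neq0; rewrite (ce y) big_ord0 eqxx.
rewrite (bigD1 d0)//= ltr_wpDr ?sumr_ge0// => [i _|]; first exact: sq_ge0.
rewrite sq_gt0; apply/eqP.
move=> /(dense_range_injective fa)/(dense_range_injective fx) e0.
have := oe _ _ (ltn_ord d0) (ltn_ord d0); rewrite e0 inner0l eqxx => /eqP.
by rewrite eq_sym oner_eq0.
Qed.

(** Finitely many b's being given in L, all the triple products on which an inner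
    derivation built from them depends at (a, x) vanish, while the real part of
    the form does not. *)
Lemma noninner_trace_form (P : E -> Prop) : rich P ->
  (forall (r : R) a, P a -> P (r%:C *: a)) ->
  exists d e (T : bounded_op H H), [/\ orthonormal e d, spanning e d, skew T &
    forall L : seq E, exists a x, [/\ P a, P x,
      0 < complex.Re (trace_form d e T a x) &
      forall b, b \in L -> t b x a = 0 /\ t b a x = 0]].
Proof.
move=> Prich PZ; have [P0 PD _] := Prich.
have [z [Pz fz oz]] := dense_range_sequence K_fin H_inf Prich.
have [d [e [oe ce]]] := orthonormal_basis_exists K_fin.
pose a k := z k.*2; pose x k := z k.*2.+1.
pose p k := cube (x k); pose q k := cube (a k).
have aa k l : k != l -> rorth (a k) (a l).
  by move=> kl; apply: oz; rewrite (inj_eq double_inj).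
have xx k l : k != l -> rorth (x k) (x l).
  by move=> kl; apply: oz; rewrite eqSS (inj_eq double_inj).
have xa k l : rorth (x k) (a l).
  by apply: oz; apply/eqP => /(congr1 odd); rewrite /= !odd_double.
have ax k l : rorth (a k) (x l) by exact/rorth_sym/xa.
have [c [T [c0 Tsk hT]]] :=
  skew_operator_series (fun k => skew_rotation (p k) (q k)).
exists d, e, T; split=> // L.
have [N [g [[l0 gl0] hg]]] := real_comb_annihilate a x L.
have Pcomb (y : nat -> E) : (forall k, P (y k)) -> P (real_comb g y).
  by move=> Py; apply: big_ind => // l _; exact/PZ/Py.
exists (real_comb g a), (real_comb g x).
(* of the series defining T only the term k = l = m survives *)
have pairing l m i :
    rin (T ((a l)^† (e i))) ((x m)^† (e i)) = (l == m)%:R *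
      (c l * rin (a l ((a l)^† (a l ((a l)^† (e i)))))
                 (x l ((x l)^† (x l ((x l)^† (e i)))))).
  have px k y : k != m -> p k ((x m)^† y) = 0.
    by move=> km; rewrite /p cubeE (xx k m)// !linear0.
  have qx k y : q k ((x m)^† y) = 0 by rewrite /q cubeE ax !linear0.
  have pa k y : p k ((a l)^† y) = 0 by rewrite /p cubeE xa !linear0.
  have qa k y : k != l -> q k ((a l)^† y) = 0.
    by move=> km; rewrite /q cubeE (aa k l)// !linear0.
  have rotE k : rin (rotation (p k) (q k) ((a l)^† (e i))) ((x m)^† (e i)) =
      rin (q k ((a l)^† (e i))) (p k ((x m)^† (e i))).
    by rewrite rotationE pa linear0 subr0 [RHS]rin_adjr.
  rewrite (hT _ _ l); last by move=> k kl; rewrite rotE qa// rin0l.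
  rewrite rotE; have [<-|lm] := eqVneq l m.
    by rewrite /p /q !cubeE mul1r.
  by rewrite px// rin0r mulr0 mul0r.
have tr l : 0 < \sum_(i < d) rin (a l ((a l)^† (a l ((a l)^† (e i)))))
    (x l ((x l)^† (x l ((x l)^† (e i))))).
  by apply: trace_squares_gt0 => //; exact: fz.
split; try by apply: Pcomb => k; exact: Pz.
  have -> : complex.Re (trace_form d e T (real_comb g a) (real_comb g x)) =
      \sum_(i < d) \sum_(l < N) g l ^+ 2 * (c l *
        rin (a l ((a l)^† (a l ((a l)^† (e i)))))
            (x l ((x l)^† (x l ((x l)^† (e i)))))).
    rewrite /trace_form /trace raddf_sum; apply: eq_bigr => i _.
    rewrite -[LHS]/(rin _ _) rin_adj !real_comb_adj linear_sum rin_suml.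
    apply: eq_bigr => l _; rewrite /= linearZ rinZl rin_sumr (bigD1 l)//=.
    rewrite rinZr pairing eqxx mul1r big1 ?addr0 ?mulrA//.
    move=> m ml; rewrite rinZr pairing eq_sym.
    by rewrite (_ : (nat_of_ord m == l) = false) ?mul0r ?mulr0//; apply/negbTE.
  rewrite exchange_big/=; under eq_bigr do rewrite -!mulr_sumr.
  have pos l : 0 <= g l ^+ 2 * (c l * \sum_(i < d)
      rin (a l ((a l)^† (a l ((a l)^† (e i)))))
          (x l ((x l)^† (x l ((x l)^† (e i)))))).
    by rewrite mulr_ge0 ?sqr_ge0// mulr_ge0// ltW.
  rewrite (bigD1 l0)//= ltr_wpDr ?sumr_ge0// mulr_gt0//.
    by rewrite lt_def sqrf_eq0 gl0 sqr_ge0.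
  by rewrite mulr_gt0.
move=> b /hg[ab xb].
have axg : rorth (real_comb g a) (real_comb g x).
  move=> y; rewrite real_comb_adj linear_sum big1// => l _.
  rewrite /= real_combE big1// => m _.
  by rewrite linearZ /= ax !scaler0.
have xag := rorth_sym axg; have bx := rorth_sym xb; have ba := rorth_sym ab.
by split; apply: op_ext => h; rewrite tripleE ?bx ?ba ?axg ?xag addr0 scaler0.
Qed.

End NonInner.

(** * Failure of ternary weak amenability *)

(** Common to the scalar fields R and R[i]. Subtraction in the first variable is
    a separate hypothesis because nothing is assumed of [rc_conj]. *)
Lemma sesquilinear_to_dual (R : realType) (k : rclikeType R)
    (F : normedModType k) (B : F -> F -> k) (M : k) :
  0 <= M ->
  (forall a, linear (B a : F -> k^o)) ->
  (forall (r : k) a b x, B (r *: a + b) x = rc_conj r * B a x + B b x) ->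
  (forall a b x, B (a - b) x = B a x - B b x) ->
  (forall a x, `|B a x| <= M * `|a| * `|x|) ->
  exists delta : F -> dual F, [/\ forall a x, delta a x = B a x,
    (forall (r : k) a b, delta (r *: a + b) = rc_conj r *: delta a + delta b) &
    continuous delta].
Proof.
move=> M0 Bl Bc BB BM.
have Bop a : exists f : dual F, forall x, f x = B a x.
  have Bcl : B a \in @continuous_linear R k F k^o.
    apply/asboolP; split; first exact: Bl.
    apply: (@additive_bounded_continuous _ _ _ _ (M * `|a|)) => [x y|x].
      by have := Bl a (-1) y x; rewrite !scaleN1r ![- _ + _]addrC.
    exact: BM.
  by exists (BoundedOp Bcl).
have [delta hd] := choice Bop.
exists delta; split=> // [r a b|].
  by apply/val_inj/funext => x /=; rewrite hd Bc -!hd.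
apply: (@additive_bounded_continuous _ _ _ _ M) => [a b|a].
  by apply/val_inj/funext => x /=; rewrite hd BB -!hd.
apply: opnorm_le => [|x]; first by rewrite mulr_ge0.
by rewrite hd BM.
Qed.

Section FinalTheorem.
Context {R : realType} {H K : hilbertType R}.
Local Notation t := (@cartan_triple R H K).
Hypothesis K_neq0 : exists y : K, y != 0.
Hypothesis K_fin : finite_dimensional K.
Hypothesis H_inf : ~ finite_dimensional H.

Lemma not_twa_complex : ~ ternary_weakly_amenable t.
Proof.
have [//|d [e [T [oe ce Tsk hT]]]] :=
  noninner_trace_form K_neq0 K_fin H_inf (rich_setT (H := H) (K := K)).
have [|||||delta [dE dl dc]] := @sesquilinear_to_dual R R[i] (bounded_op H K)
    (trace_form d e T) (d%:R * `|T|).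
- by rewrite mulr_ge0.
- by move=> a r x y; exact: trace_form_linear_r.
- by move=> r a b x; exact: trace_form_conj_l.
- by move=> a b x; have := trace_form_conj_l d e T (-1) b a x;
     rewrite scaleN1r rmorphN1 mulN1r addrC => ->; rewrite addrC.
- by move=> a x; exact: trace_form_bound.
move=> /(_ delta) [||s hs].
- split; first exact: dl.
  move=> a b c x; rewrite /outer_product /middle_product !dE.
  exact: trace_form_derivation.
- exact: dc.
have [a [x [_ _ pos tL]]] := hT [seq p.1 | p <- s].
suff : trace_form d e T a x = 0 by move=> z; rewrite z /= ltxx in pos.
rewrite -dE hs big_seq big1// => p ps.
have [h1 h2] := tL p.1 (map_f _ ps).
rewrite /inner_derivation /middle_product /outer_product h1 h2 linear0.
by rewrite [rc_conj 0](_ : _ = 0) ?subrr//; exact: rmorph0.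
Qed.

Variable tau : conjugation (bounded_op H K).
Local Notation F := (real_form tau).
Local Notation tF := (@real_form_triple R _ tau t).

(** The default value in the definition of the product is never reached, tau
    being a triple automorphism. *)
Lemma val_real_form_triple (a b c : F) :
  val (tF a b c) = t (val a) (val b) (val c).
Proof.
rewrite /real_form_triple insubdK//; apply/eqP.
by rewrite tau_triple// !real_form_fixed.
Qed.

Lemma real_form_normE (a : F) : (`|a|)%:C = `|val a| :> R[i].
Proof. by rewrite -[RHS]complex_rc_reK// normr_ge0. Qed.

Lemma not_twa_real_form : ~ ternary_weakly_amenable tF.
Proof.
have [|d [e [T [oe ce Tsk hT]]]] :=
  noninner_trace_form K_neq0 K_fin H_inf (rich_fixed K_fin tau).
  by move=> r a ta; rewrite tauZr ta.
pose B (a x : F) : R := complex.Re (trace_form d e T (val a) (val x)).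
pose M := complex.Re (d%:R * `|T|).
have ME : M%:C = d%:R * `|T| by rewrite complex_rc_reK// mulr_ge0// normr_ge0.
have [|||||delta [dE dl dc]] := @sesquilinear_to_dual R R F B M.
- by rewrite -lecR ME mulr_ge0// normr_ge0.
- move=> a r x y; rewrite /B trace_form_linear_r raddfD/=; congr (_ + _).
  by case: (trace_form _ _ _ _ _) => u w /=; rewrite mul0r subr0.
- move=> r a b x; rewrite /B trace_form_conj_l conj_real raddfD/=.
  congr (_ + _).
  by case: (trace_form _ _ _ _ _) => u w /=; rewrite mul0r subr0.
- move=> a b x; have := trace_form_conj_l d e T (-1) (val b) (val a) (val x).
  rewrite scaleN1r rmorphN1 mulN1r addrC /B => ->.
  by rewrite addrC raddfB.
- move=> a x; rewrite -lecR !rmorphM/= !real_form_normE ME.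
  exact: le_trans (normc_ge_Re _) (trace_form_bound oe _ _ _).
move=> /(_ delta) [||s hs].
- split; first exact: dl.
  move=> a b c x; rewrite /outer_product /middle_product !dE /B.
  rewrite !val_real_form_triple (trace_form_derivation ce Tsk).
  move: (trace_form _ _ _ _ _) (trace_form _ _ _ _ _) (trace_form _ _ _ _ _).
  move=> u v w.
  by rewrite !raddfD; case: v.
- exact: dc.
have [a [x [ta tx pos tL]]] := hT [seq val p.1 | p <- s].
pose a' : F := RealForm (introT eqP ta). 
pose x' : F := RealForm (introT eqP tx).
suff : B a' x' = 0 by move=> z; rewrite -[ltRHS]/(B a' x') z ltxx in pos.
rewrite -dE hs big_seq big1// => p ps.
have [h1 h2] := tL (val p.1) (map_f _ ps).
rewrite /inner_derivation /middle_product /outer_product.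
have -> : tF p.1 x' a' = 0 by apply: val_inj; rewrite val_real_form_triple h1.
have -> : tF p.1 a' x' = 0 by apply: val_inj; rewrite val_real_form_triple h2.
by rewrite linear0 subrr.
Qed.

End FinalTheorem.

Theorem corollary5p7 (R : realType) (H K : hilbertType R)
  (K_neq0 : exists y : K, y != 0)
  (K_fin : finite_dimensional K)
  (H_inf : ~ finite_dimensional H) :
  ~ ternary_weakly_amenable (@cartan_triple R H K) /\
  (forall tau : conjugation (bounded_op H K),
     ~ ternary_weakly_amenable (@real_form_triple R _ tau (@cartan_triple R H K))).
Proof.
split; first exact: not_twa_complex.
by move=> tau; exact: not_twa_real_form.
Qed.
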